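(* Let $K$ be a field and let $\Lambda=\Lambda_\Gamma$ be the Brauer configuration algebra of a Brauer configuration $\Gamma$. (1) There is a bijective correspondence between the set of (isomorphism classes of) projective indecomposable $\Lambda$-modules and the set $\Gamma_1$ of polygons of $\Gamma$. (2) If $P$ is a projective indecomposable $\Lambda$-module corresponding to a polygon $V$ of $\Gamma$ (that is, $P\cong e_v\Lambda$, where $v$ is the vertex of $\mathcal Q_\Gamma$ associated to $V$ and $e_v$ the corresponding idempotent), then $\mathrm{rad}(P)$ is a sum of $r$ indecomposable uniserial modules, where $r$ is the number of nontruncated vertices of $V$ (counted with repetitions), and where the intersection of any two of these uniserial modules is a simple $\Lambda$-module.
   Context: Modules are right modules. Brauer configuration. A Brauer configuration $\Gamma=(\Gamma_0,\Gamma_1,\mu,\mathfrak o)$ consists of a finite set $\Gamma_0$ of vertices, a finite collection $\Gamma_1$ of labelled finite multisets of elements of $\Gamma_0$, called polygons (differently labelled polygons may be equal as multisets; a $d$-gon is a polygon with $d$ elements counted with multiplicity), a multiplicity function $\mu\colon\Gamma_0\to\mathbb Z_{>0}$, and an orientation $\mathfrak o$. For $\alpha\in\Gamma_0$, $V\in\Gamma_1$, $\mathrm{occ}(\alpha,V)$ is the number of times $\alpha$ occurs in $V$, and $\mathrm{val}(\alpha)=\sum_{V\in\Gamma_1}\mathrm{occ}(\alpha,V)$. An orientation is a choice, for each $\alpha\in\Gamma_0$, of a cyclic ordering of the list of polygons containing $\alpha$, where each $V$ is listed $\mathrm{occ}(\alpha,V)$ times (the different occurrences being distinguished). It is required that: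 every vertex lies in at least one polygon; every polygon has at least two vertices (counted with multiplicity); every polygon contains a vertex $\alpha$ with $\mathrm{val}(\alpha)\mu(\alpha)>1$. A vertex $\alpha$ is truncated if $\mathrm{val}(\alpha)\mu(\alpha)=1$, and nontruncated otherwise. Quiver. $\mathcal Q_\Gamma$ has one vertex $v$ for each polygon $V\in\Gamma_1$. For a nontruncated $\alpha$, the cyclically ordered list $V_1<\dots<V_t$ ($t=\mathrm{val}(\alpha)$, $V_{t+1}=V_1$) given by $\mathfrak o$ is the successor sequence at $\alpha$; for each $r=1,\dots,t$ there is an arrow $a_r$ from the vertex $v_r$ associated to $V_r$ to the vertex $v_{r+1}$ associated to $V_{r+1}$ (a loop if $t=1$). The arrows obtained for different $\alpha$ and different $r$ are distinct, and these are all arrows of $\mathcal Q_\Gamma$. Paths are written from left to right. Special cycles. With this notation put $C_j=a_ja_{j+1}\cdots a_ta_1\cdots a_{j-1}$. If $V$ is a polygon containing $\alpha$, the special $\alpha$-cycles at $v$ are the $C_j$ with $V_j=V$ (so there are $\mathrm{occ}(\alpha,V)$ of them). Algebra. $\Lambda_\Gamma=K\mathcal Q_\Gamma/I_\Gamma$, where $I_\Gamma$ is generated by: (type one) all $C^{\mu(\alpha)}-(C')^{\mu(\beta)}$ where, for some polygon $V$, $C$ is a special $\alpha$-cycle at $v$ and $C'$ is a special $\beta$-cycle at $v$, with $\alpha,\beta$ nontruncated vertices of $V$ (possibly $\alpha=\beta$); (type two) all $C^{\mu(\alpha)}a$ where $C$ is a special $\alpha$-cycle and $a$ is the first arrow of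 $C$; (type three) all paths $ab$ of length two that are not a subpath of any special cycle, except those with $a=b$ a loop associated to a vertex $\alpha$ with $\mathrm{val}(\alpha)=1$ and $\mu(\alpha)>1$. *)

(* Defs.v *)
From HB Require Import structures.
From mathcomp Require Import all_boot all_algebra perm.
From mathcomp Require Import finmap multiset.
From mathcomp Require Import boolp.
From mathcomp.multinomials Require Import monalg.

Set Implicit Arguments.
Unset Strict Implicit.
Unset Printing Implicit Defensive.

Import GRing.Theory.
Local Open Scope ring_scope.
Local Open Scope mset_scope.

(** * Modules *)

(* Right modules over [A] are [lmodType]s over the converse ring [A^c]:
   for [x : A^c], [x *: m] stands for m.x, and
   x *: (y *: m) = (x *_(A^c) y) *: m = m.(yx). *)
Notation rmodType A := (GRing.Lmodule.type A^c).

Section Modules.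
Variable A : pzRingType.
Implicit Types M N P : lmodType A.

(* Submodules are the library's [submodClosed] predicates; this is the
   corresponding module. *)
Inductive submodule M (U : submodClosed M) :=
  Submodule { submod_val :> M; _ : submod_val \in U }.

HB.instance Definition _ M (U : submodClosed M) :=
  [isSub for @submod_val M U].
HB.instance Definition _ M (U : submodClosed M) :=
  [Choice of submodule U by <:].
Fact submodule_closed M (U : submodClosed M) : submod_closed (fun x => x \in U).
Proof.
split=> [|a x y xU yU]; first exact: (rpred0 U).
exact: (@rpredD _ U _ _ (@rpredZ _ _ U a _ xU) yU).
Qed.
HB.instance Definition _ M (U : submodClosed M) :=
  GRing.SubChoice_isSubLmodule.Build A M (fun x => x \in U) (submodule U)
    (GRing.submod_closed_semi (submodule_closed U)).

Definition submodI M (U V : submodClosed M) : {pred M} :=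
  [pred x | (x \in U) && (x \in V)].

Fact submodI_closed M (U V : submodClosed M) : submod_closed (submodI U V).
Proof.
split=> [|a x y]; rewrite !inE ?rpred0 //.
by move=> /andP[xU xV] /andP[yU yV]; rewrite !rpredD ?rpredZ.
Qed.
HB.instance Definition _ M (U V : submodClosed M) :=
  GRing.isSubmodClosed.Build A M (submodI U V) (submodI_closed U V).

Definition isomorphic M N := exists f : {linear M -> N}, bijective f.

Definition projective P :=
  forall M N (g : {linear M -> N}) (f : {linear P -> N}),
    (forall y, exists x, g x = y) -> exists h : {linear P -> M}, g \o h =1 f.

Definition indecomposable M :=
  (exists x : M, x != 0) /\
  forall U V : submodClosed M,
    (forall x, exists u v, [/\ u \in U, v \in V & x = u + v]) ->
    (forall x, x \in U -> x \in V -> x = 0) ->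
    {in U, forall x, x = 0} \/ {in V, forall x, x = 0}.

Definition simple M :=
  (exists x : M, x != 0) /\
  forall U : submodClosed M, {in U, forall x, x = 0} \/ (forall x, x \in U).

Definition uniserial M :=
  forall U V : submodClosed M, {subset U <= V} \/ {subset V <= U}.

Definition maximal_submod M (U : submodClosed M) :=
  (exists x, x \notin U) /\
  forall V : submodClosed M,
    {subset U <= V} -> {subset V <= U} \/ (forall x, x \in V).

Definition radical M (x : M) :=
  forall U : submodClosed M, maximal_submod U -> x \in U.

Definition sum_submod M n (U : 'I_n -> submodClosed M) (x : M) :=
  exists2 u : 'I_n -> M, (forall i, u i \in U i) & x = \sum_(i < n) u i.

(* The isomorphism classes of projective indecomposable modules; an
   isomorphism class is the predicate it defines on modules. *)
Definition pi_class :=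
  {C : lmodType A -> Prop |
    exists P, [/\ projective P, indecomposable P & C = isomorphic P]}.

End Modules.

(** * Quotient of a ring by the two-sided ideal generated by a set *)

Section Ideal.
Variables (A : pzRingType) (S : A -> Prop).

Inductive ideal_gen : A -> Prop :=
| ideal_gen_sub x of S x : ideal_gen x
| ideal_gen0 : ideal_gen 0
| ideal_genD x y of ideal_gen x & ideal_gen y : ideal_gen (x + y)
| ideal_genMl a x of ideal_gen x : ideal_gen (a * x)
| ideal_genMr x a of ideal_gen x : ideal_gen (x * a).

Definition genid : {pred A} := fun x => `[< ideal_gen x >].

Fact genid_zmod_closed : zmod_closed genid.
Proof.
split=> [|x y /asboolP xI /asboolP yI]; apply/asboolP; first exact: ideal_gen0.
by apply: ideal_genD => //; rewrite -mulN1r; apply: ideal_genMl.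
Qed.
HB.instance Definition _ := GRing.isZmodClosed.Build A genid genid_zmod_closed.

Definition qring : Type := Quotient.quot genid.
HB.instance Definition _ := GRing.Zmodule.on qring.

(* [ring_quotient] only provides the ring structure when [A] is commutative. *)
Definition qproj (x : A) : qring := (\pi_(Quotient.quot genid) x)%qT.
Definition qrepr (x : qring) : A := repr (x : Quotient.quot genid).

Lemma qreprK : cancel qrepr qproj. Proof. exact: reprK. Qed.

Lemma qprojP x y : qproj x = qproj y <-> ideal_gen (x - y).
Proof.
rewrite /qproj; split=> [/eqP|xyI].
  by rewrite -Quotient.idealrBE => /asboolP.
by apply/eqP; rewrite -Quotient.idealrBE; apply/asboolP.
Qed.

Lemma qprojD : {morph qproj : x y / x + y}.
Proof. by move=> x y; rewrite /qproj raddfD. Qed.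

Definition qone := qproj 1.
Definition qmul (x y : qring) := qproj (qrepr x * qrepr y).

Lemma qprojM x y : qmul (qproj x) (qproj y) = qproj (x * y).
Proof.
apply/qprojP; set x' := qrepr _; set y' := qrepr _.
have -> : x' * y' - x * y = (x' - x) * y' + x * (y' - y).
  by rewrite mulrBl mulrBr addrA subrK.
by apply: ideal_genD; [apply: ideal_genMr | apply: ideal_genMl];
  apply/qprojP; rewrite qreprK.
Qed.

Fact qmulA : associative qmul.
Proof.
by move=> x y z; rewrite -[x]qreprK -[y]qreprK -[z]qreprK !qprojM mulrA.
Qed.
Fact qmul1 : left_id qone qmul.
Proof. by move=> x; rewrite -[x]qreprK qprojM mul1r. Qed.
Fact q1mul : right_id qone qmul.
Proof. by move=> x; rewrite -[x]qreprK qprojM mulr1. Qed.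
Fact qmulDl : left_distributive qmul +%R.
Proof.
move=> x y z; rewrite -[x]qreprK -[y]qreprK -[z]qreprK.
by rewrite -qprojD !qprojM -qprojD mulrDl.
Qed.
Fact qmulDr : right_distributive qmul +%R.
Proof.
move=> x y z; rewrite -[x]qreprK -[y]qreprK -[z]qreprK.
by rewrite -qprojD !qprojM -qprojD mulrDr.
Qed.
HB.instance Definition _ :=
  GRing.Zmodule_isPzRing.Build qring qmulA qmul1 q1mul qmulDl qmulDr.

Fact qproj_zmod : zmod_morphism qproj.
Proof. by move=> x y; rewrite /qproj raddfB. Qed.
HB.instance Definition _ :=
  GRing.isZmodMorphism.Build A qring qproj qproj_zmod.
Fact qproj_monoid : monoid_morphism qproj.
Proof. by split=> // x y; rewrite -qprojM. Qed.
HB.instance Definition _ :=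
  GRing.isMonoidMorphism.Build A qring qproj qproj_monoid.

End Ideal.

(** * Path algebras *)

Record quiver := Quiver {
  qvertex : finType;
  qarrow : finType;
  qsrc : qarrow -> qvertex;
  qtgt : qarrow -> qvertex }.

Section PathAlgebra.
Variable Q : quiver.

Fixpoint walk (v : qvertex Q) (s : seq (qarrow Q)) : bool :=
  if s is a :: s' then (qsrc a == v) && walk (qtgt a) s' else true.

(* A path is given by its source and its arrows, read from left to right;
   [(v, [::])] is the trivial path at [v]. *)
Record qpath := QPath {
  path_val :> qvertex Q * seq (qarrow Q); _ : walk path_val.1 path_val.2 }.
HB.instance Definition _ := [isSub for path_val].
HB.instance Definition _ := [Choice of qpath by <:].

Definition path_src (p : qpath) := p.1.
Definition path_tgt (p : qpath) := last (path_src p) (map (@qtgt Q) p.2).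
Definition path_cat (p q : qpath) : option qpath :=
  if path_tgt p == path_src q
  then insub (path_src p, p.2 ++ q.2) else None.
Definition path_nil (v : qvertex Q) : qpath := @QPath (v, [::]) isT.

Fact walk_arrow a : walk (qsrc a) [:: a]. Proof. by rewrite /= eqxx. Qed.
Definition path_arrow (a : qarrow Q) : qpath :=
  @QPath (qsrc a, [:: a]) (walk_arrow a).

Lemma walk_cat v s1 s2 :
  walk v (s1 ++ s2) = walk v s1 && walk (last v (map (@qtgt Q) s1)) s2.
Proof. by elim: s1 v => //= a s1 IH v; rewrite IH andbA. Qed.

Variant path_cat_spec p q : option qpath -> Type :=
| PathCat r of path_tgt p = path_src q & path_val r = (path_src p, p.2 ++ q.2)
  : path_cat_spec p q (Some r)
| NoPathCat of path_tgt p <> path_src q : path_cat_spec p q None.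

Lemma path_catP p q : path_cat_spec p q (path_cat p q).
Proof.
rewrite /path_cat; case: eqP => [pq|]; last by constructor.
case: insubP => [r _ rE|]; first by constructor.
rewrite /= walk_cat -/(path_src p) -/(path_tgt p) pq.
by rewrite (valP p) (valP q).
Qed.

Lemma path_src_cat p q r : path_cat p q = Some r -> path_src r = path_src p.
Proof. by case: path_catP => // r' _ rE [<-]; rewrite /path_src rE. Qed.

Lemma path_tgt_cat p q r : path_cat p q = Some r -> path_tgt r = path_tgt q.
Proof.
case: path_catP => // r' pq rE [<-]; rewrite /path_tgt /path_src rE /=.
by rewrite map_cat last_cat -/(path_src p) -/(path_tgt p) pq.
Qed.

Lemma path_catA p q r :
  obind (path_cat p) (path_cat q r) = obind (path_cat^~ r) (path_cat p q).
Proof.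
case E1: (path_cat q r) => [qr|]; case E2: (path_cat p q) => [pq|] //=.
- have s1 := path_src_cat E1; have t2 := path_tgt_cat E2.
  have qrE : path_val qr = (path_src q, q.2 ++ r.2).
    by case: path_catP E1 => // x _ xE [<-].
  have pqE : path_val pq = (path_src p, p.2 ++ q.2).
    by case: path_catP E2 => // x _ xE [<-].
  have pq_ : path_tgt p = path_src q by case: path_catP E2.
  have qr_ : path_tgt q = path_src r by case: path_catP E1.
  case: path_catP => [x _ xE|]; last by rewrite s1.
  case: path_catP => [y _ yE|]; last by rewrite t2.
  congr Some; apply: val_inj.
  by rewrite /= xE yE qrE pqE /path_src pqE /= catA.
- have s1 := path_src_cat E1.
  by case: path_catP E2 => // npq _; case: path_catP => // x; rewrite s1.
- have t2 := path_tgt_cat E2.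
  by case: path_catP E1 => // nqr _; case: path_catP => // x; rewrite t2.
Qed.

Variable K : fieldType.

(* The K-vector space with basis the paths. *)
Definition path_alg : Type := {malg K[qpath]}.
HB.instance Definition _ := GRing.Lmodule.on path_alg.

Definition path_elt (p : qpath) : path_alg := << p >>.

(* The linear extension of a map defined on paths. *)
Definition path_lin (h : qpath -> path_alg) (f : path_alg) : path_alg :=
  \sum_(p <- msupp f) mcoeff p f *: h p.

Definition path_mul2 (p q : qpath) : path_alg :=
  oapp path_elt 0 (path_cat p q).

Definition path_mul (f g : path_alg) : path_alg :=
  path_lin (fun p => path_lin (path_mul2 p) g) f.

Definition path_one : path_alg := \sum_(v : qvertex Q) path_elt (path_nil v).

Lemma path_linw h (f : path_alg) (D : {fset qpath}) :
  (msupp f `<=` D)%fset -> path_lin h f = \sum_(p <- D) mcoeff p f *: h p.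
Proof.
move=> fD; rewrite /path_lin (big_fset_incl _ fD) // => p _ pf.
by rewrite mcoeff_outdom ?scale0r.
Qed.

Fact path_lin_linear h : linear (path_lin h).
Proof.
move=> c f g; pose D := (msupp f `|` msupp g `|` msupp (c *: f + g))%fset.
have [fD gD hD] : [/\ (msupp f `<=` D)%fset, (msupp g `<=` D)%fset
    & (msupp (c *: f + g) `<=` D)%fset].
  by split; apply/fsubsetP => p pD; rewrite !in_fsetU pD ?orbT.
rewrite (path_linw h fD) (path_linw h gD) (path_linw h hD).
rewrite scaler_sumr -big_split; apply: eq_bigr => p _ /=.
by rewrite mcoeffD mcoeffZ scalerDl scalerA.
Qed.
HB.instance Definition _ h :=
  GRing.isLinear.Build K path_alg path_alg *:%R (path_lin h) (path_lin_linear h).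

Lemma path_linE h p : path_lin h (path_elt p) = h p.
Proof.
rewrite /path_lin /path_elt msuppU oner_eq0 big_seq_fset1.
by rewrite mcoeffUU scale1r.
Qed.

Lemma path_algE (f : path_alg) : f = path_lin path_elt f.
Proof.
rewrite [LHS]monalgE /path_lin; apply: eq_bigr => p _.
by apply/malgP => q; rewrite mcoeffZ !mcoeffU mulrnAr mulr1.
Qed.

Lemma eq_path_lin h1 h2 : h1 =1 h2 -> path_lin h1 =1 path_lin h2.
Proof. by move=> eqh f; apply: eq_bigr => p _; rewrite eqh. Qed.

Lemma path_lin_comp (phi : {linear path_alg -> path_alg}) h f :
  phi (path_lin h f) = path_lin (fun p => phi (h p)) f.
Proof. by rewrite linear_sum; apply: eq_bigr => p _; rewrite linearZ. Qed.

Lemma path_linD h1 h2 f :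
  path_lin (fun p => h1 p + h2 p) f = path_lin h1 f + path_lin h2 f.
Proof.
by rewrite -big_split; apply: eq_bigr => p _; rewrite /= scalerDr.
Qed.

Lemma path_linZ c h f : path_lin (fun p => c *: h p) f = c *: path_lin h f.
Proof.
by rewrite scaler_sumr; apply: eq_bigr => p _; rewrite !scalerA mulrC.
Qed.

Definition path_mulr g f := path_mul f g.

Fact path_mul_linearl g : linear (path_mulr g).
Proof. by move=> c f1 f2; rewrite /path_mulr /path_mul linearP. Qed.
HB.instance Definition _ g := GRing.isLinear.Build K path_alg path_alg *:%R
  (path_mulr g) (path_mul_linearl g).

Fact path_mul_linearr f : linear (path_mul f).
Proof.
move=> c g1 g2; rewrite /path_mul -path_linZ -path_linD.
by apply: eq_path_lin => p; rewrite linearP.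
Qed.
HB.instance Definition _ f := GRing.isLinear.Build K path_alg path_alg *:%R
  (path_mul f) (path_mul_linearr f).

Lemma path_mul0l g : path_mul 0 g = 0. Proof. exact: (linear0 (path_mulr g)). Qed.
Lemma path_mul0r f : path_mul f 0 = 0. Proof. exact: (linear0 (path_mul f)). Qed.

Lemma path_mulE p q : path_mul (path_elt p) (path_elt q) = path_mul2 p q.
Proof. by rewrite /path_mul !path_linE. Qed.

Lemma path_lin_ext (phi psi : {linear path_alg -> path_alg}) :
  (forall p, phi (path_elt p) = psi (path_elt p)) -> phi =1 psi.
Proof.
by move=> E f; rewrite [f]path_algE !path_lin_comp; apply: eq_path_lin.
Qed.

Fact path_mulA : associative path_mul.
Proof.
move=> f g h; move: f.
apply: (@path_lin_ext (path_mulr (path_mul g h))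
  (path_mulr h \o path_mulr g)) => p /=; rewrite /path_mulr.
move: g; apply: (@path_lin_ext (path_mul (path_elt p) \o path_mulr h)
  (path_mulr h \o path_mul (path_elt p))) => q /=; rewrite /path_mulr.
move: h; apply: (@path_lin_ext (path_mul (path_elt p) \o path_mul (path_elt q))
  (path_mul (path_mul (path_elt p) (path_elt q)))) => r /=.
have := path_catA p q r; rewrite !path_mulE /path_mul2.
case: (path_cat q r) (path_cat p q) => [x|] [y|] //=;
  rewrite ?path_mulE ?path_mul0l ?path_mul0r /path_mul2 //=; by [move=> -> | move=> <-].
Qed.

Fact path_mul1 : left_id path_one path_mul.
Proof.
move=> f; rewrite -[LHS]/(path_mulr f _) linear_sum /path_mulr /=; move: f.
have lin : linear (fun f => \sum_v path_mul (path_elt (path_nil v)) f).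
  move=> c f g; rewrite scaler_sumr -big_split.
  by apply: eq_bigr => v _; rewrite linearP.
pose L : {linear path_alg -> path_alg} := HB.pack
  (fun f => \sum_v path_mul (path_elt (path_nil v)) f)
  (GRing.isLinear.Build K path_alg path_alg *:%R _ lin).
apply: (@path_lin_ext L idfun) => p /=.
rewrite (bigD1 (path_src p)) //= big1 ?addr0 => [|v vp]; rewrite path_mulE /path_mul2;
  case: path_catP => //=.
- by move=> r _ rE; congr path_elt; apply: val_inj; rewrite /= rE /path_src /=; case: (path_val p).
- by move=> r rp; rewrite -rp eqxx in vp.
Qed.

Fact path_1mul : right_id path_one path_mul.
Proof.
move=> f; rewrite linear_sum /=; move: f.
have lin : linear (fun f => \sum_v path_mul f (path_elt (path_nil v))).
  move=> c f g; rewrite scaler_sumr -big_split.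
  by apply: eq_bigr => v _; exact: (linearP (path_mulr _)).
pose L : {linear path_alg -> path_alg} := HB.pack
  (fun f => \sum_v path_mul f (path_elt (path_nil v)))
  (GRing.isLinear.Build K path_alg path_alg *:%R _ lin).
apply: (@path_lin_ext L idfun) => p /=.
rewrite (bigD1 (path_tgt p)) //= big1 ?addr0 => [|v vp]; rewrite path_mulE /path_mul2;
  case: path_catP => //=.
- move=> r _ rE; congr path_elt; apply: val_inj; rewrite /= rE cats0.
  by rewrite /path_src; case: (path_val p).
- by move=> r rp; rewrite rp eqxx in vp.
Qed.

Fact path_mulDl : left_distributive path_mul +%R.
Proof. move=> f g h; exact: (linearD (path_mulr h)). Qed.
Fact path_mulDr : right_distributive path_mul +%R.
Proof. by move=> f g h; rewrite linearD. Qed.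

HB.instance Definition _ := GRing.Zmodule_isPzRing.Build path_alg
  path_mulA path_mul1 path_1mul path_mulDl path_mulDr.

Definition trivial_elt (v : qvertex Q) : path_alg := path_elt (path_nil v).
Definition arrow_elt (a : qarrow Q) : path_alg := path_elt (path_arrow a).

End PathAlgebra.

(** * Brauer configurations *)

(* The occurrences of the vertex [x] in the polygons: [V] is listed
   [occ(x, V)] times. *)
Notation occurrence_in polygon x := {V : _ & 'I_(polygon V x)}.

(* The labels of the polygons form the finite type [plabel]; the polygon
   labelled [V] is the multiset [polygon V], so that [polygon V x] is
   occ(x, V).  A cyclic ordering of a finite set is given by its successor
   function, a permutation with a single cycle. *)
Record brauer_config := BrauerConfig {
  vertex : finType;
  plabel : finType;
  polygon : plabel -> {mset vertex};
  mu : vertex -> nat;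
  orient : forall x : vertex, {perm occurrence_in polygon x};
  valency x := (\sum_(V : plabel) polygon V x)%N;
  mu_gt0 : forall x, (0 < mu x)%N;
  orient_cyclic : forall x (i j : occurrence_in polygon x),
    j \in porbit (orient x) i;
  vertex_occurs : forall x, exists V, x \in polygon V;
  polygon_size : forall V, (2 <= size (polygon V))%N;
  polygon_nontruncated : forall V,
    exists2 x, x \in polygon V & (1 < valency x * mu x)%N }.

Section BrauerAlgebra.
Variable G : brauer_config.

Definition truncated (x : vertex G) := (valency x * mu x == 1)%N.

(* The arrow a_r starting at the r-th term of the successor sequence at [x]
   is identified with that term, an occurrence of the nontruncated [x]. *)
Definition barrow :=
  {a : {x : vertex G & occurrence_in (@polygon G) x} | ~~ truncated (tag a)}.

Definition avertex (a : barrow) : vertex G := tag (sval a).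
Definition aocc (a : barrow) : occurrence_in (@polygon G) (avertex a) :=
  tagged (sval a).
Definition anext (a : barrow) : barrow :=
  exist _ (Tagged (fun x => occurrence_in (@polygon G) x)
                  (orient (avertex a) (aocc a))) (svalP a).

Definition bquiver : quiver :=
  @Quiver (plabel G) barrow (fun a => tag (aocc a))
          (fun a => tag (aocc (anext a))).

(* The special cycle with first arrow [a]; it is a special
   [avertex a]-cycle at the source of [a]. *)
Definition special_cycle (a : barrow) : seq barrow :=
  traject anext a (valency (avertex a)).

Variable K : fieldType.

Local Notation KQ := (path_alg bquiver K).
Local Notation arr := (@arrow_elt bquiver K).

Definition cycle_elt (a : barrow) : KQ := \prod_(b <- special_cycle a) arr b.
Definition cycle_pow (a : barrow) : KQ := cycle_elt a ^+ mu (avertex a).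

Inductive brauer_rel : KQ -> Prop :=
| brauer_rel1 (a b : barrow) of tag (aocc a) = tag (aocc b) :
    brauer_rel (cycle_pow a - cycle_pow b)
| brauer_rel2 (a : barrow) :
    brauer_rel (cycle_pow a * arr a)
| brauer_rel3 (a b : barrow) of
    tag (aocc (anext a)) = tag (aocc b) &
    (forall c, ~~ infix [:: a; b] (special_cycle c)) &
    ~ (a = b /\ valency (avertex a) = 1%N /\ (1 < mu (avertex a))%N) :
    brauer_rel (arr a * arr b).

Definition brauer_alg : pzRingType := qring brauer_rel.

Definition idem (v : plabel G) : brauer_alg :=
  qproj brauer_rel (@trivial_elt bquiver K v).

(* The right ideal e_v Lambda, as a submodule of the right regular module. *)
Definition idem_pred (v : plabel G) : {pred (brauer_alg^c)^o} :=
  fun x => `[< exists y : brauer_alg, x = idem v * y :> brauer_alg >].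

Fact idem_closed v : submod_closed (idem_pred v).
Proof.
split=> [|c x y /asboolP[x' ->] /asboolP[y' ->]]; apply/asboolP.
  by exists 0; rewrite mulr0.
by exists (x' * (c : brauer_alg) + y'); rewrite mulrDr mulrA.
Qed.
HB.instance Definition _ v :=
  GRing.isSubmodClosed.Build (brauer_alg^c) (brauer_alg^c)^o (idem_pred v)
    (idem_closed v).

Definition proj_module (v : plabel G) : rmodType brauer_alg :=
  submodule (idem_pred v).

Definition nontruncated_count (V : plabel G) : nat :=
  \sum_(x : vertex G | ~~ truncated x) polygon V x.

End BrauerAlgebra.

(* Main.v *)
(* The arrows at a nontruncated vertex alpha form a single cycle, and a path is
   nonzero modulo the relations only if it is trivial or a run of k consecutive
   arrows with k <= N = val(alpha) mu(alpha); the runs of length N starting at v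
   all coincide.  Write J for the arrow ideal, which is nilpotent, so that an
   element of Lambda whose coefficients at the trivial paths all equal c <> 0 is
   invertible.

   Hence every nonzero element of a Lambda, for an arrow a, is a run starting
   with a times a unit, which makes a Lambda uniserial.  The linear form
   summing the coefficients of the runs of length N vanishes on the ideal of
   relations; it shows that these runs are nonzero in Lambda, and that a proper
   run starting with a lies in b Lambda only if a = b, so that the intersection
   of a Lambda and b Lambda is spanned by the common run of maximal length.

   The module e_v Lambda is local with maximal submodule e_v J, the sum of the
   a Lambda.  Conversely, the coordinates of a splitting of a free module onto a
   nonzero projective P do not all take values in J, which is nilpotent; a value
   outside J yields a surjection of P onto some e_v Lambda, which splits and is
   an isomorphism when P is indecomposable. *)
From HB Require Import structures.
Require Import Defs.
From mathcomp Require Import all_boot all_algebra perm.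
From mathcomp Require Import finmap boolp classical_sets functions fsbigop.
From mathcomp Require Import monalg.

Set Implicit Arguments.
Unset Strict Implicit.
Unset Printing Implicit Defensive.

Import GRing.Theory.

(** * Modules *)

Section Modules.
Local Open Scope ring_scope.
Variable A : pzRingType.
Implicit Types M N P : lmodType A.

Lemma isomorphic_sym M N : isomorphic M N -> isomorphic N M.
Proof.
case=> f [g fK gK].
have glin : linear g.
  by move=> c x y; apply: (can_inj fK); rewrite gK linearP !gK.
pose h : {linear N -> M} := HB.pack g (GRing.isLinear.Build A N M *:%R g glin).
by exists h, f.
Qed.

Lemma isomorphic_trans M N P :
  isomorphic M N -> isomorphic N P -> isomorphic M P.
Proof.
case=> f fbij [g gbij].
by exists (g \o f : {linear M -> P}); apply: bij_comp.
Qed.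

Lemma isomorphic_class M N : isomorphic M N -> isomorphic M = isomorphic N.
Proof.
move=> MN; apply/funext => P; apply/propext; split; apply: isomorphic_trans => //.
exact: isomorphic_sym.
Qed.

(** * Cyclic submodules, kernels and finite sums *)

Definition cyclic_submod M (x : M) : {pred M} :=
  fun y => `[< exists c, y = c *: x >].

Fact cyclic_submod_closed M (x : M) : submod_closed (cyclic_submod x).
Proof.
split=> [|c y z /asboolP[a ->] /asboolP[b ->]]; apply/asboolP.
  by exists 0; rewrite scale0r.
by exists (c * a + b); rewrite scalerDl scalerA.
Qed.
HB.instance Definition _ M (x : M) :=
  GRing.isSubmodClosed.Build A M (cyclic_submod x) (cyclic_submod_closed x).

Lemma cyclic_submodP M (x y : M) :
  reflect (exists c, y = c *: x) (y \in cyclic_submod x).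
Proof. exact: asboolP. Qed.

Definition ker_submod M N (f : {linear M -> N}) : {pred M} := fun x => f x == 0.

Fact ker_submod_closed M N (f : {linear M -> N}) : submod_closed (ker_submod f).
Proof.
split=> [|c y z]; rewrite /ker_submod !unfold_in /=; first by rewrite linear0.
by move=> /eqP y0 /eqP z0; rewrite linearP y0 z0 scaler0 addr0.
Qed.
HB.instance Definition _ M N (f : {linear M -> N}) :=
  GRing.isSubmodClosed.Build A M (ker_submod f) (ker_submod_closed f).

Definition sum_pred M n (U : 'I_n -> submodClosed M) : {pred M} :=
  fun x => `[< sum_submod U x >].

Fact sum_pred_closed M n (U : 'I_n -> submodClosed M) :
  submod_closed (sum_pred U).
Proof.
split=> [|c y z /asboolP[u uU ->] /asboolP[v vU ->]]; apply/asboolP.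
  by exists (fun=> 0) => [i|]; rewrite ?rpred0 ?big1.
exists (fun i => c *: u i + v i); first by move=> i; rewrite rpredD ?rpredZ.
by rewrite big_split scaler_sumr.
Qed.
HB.instance Definition _ M n (U : 'I_n -> submodClosed M) :=
  GRing.isSubmodClosed.Build A M (sum_pred U) (sum_pred_closed U).

(** If $x \in U \setminus V$, then $x$ is a multiple of no $y \in V$, so every $y \in V$ is a
    multiple of $x$. *)
Lemma chain_uniserial M :
  (forall x y : M, (exists c, x = c *: y) \/ (exists c, y = c *: x)) ->
  uniserial M.
Proof.
move=> chain U V; apply: or_asboolP; apply/orP.
have [UV|nUV] := pselect {subset U <= V}; first by left; apply/asboolP.
right; apply/asboolP => y yV.
have [x /not_implyP[xU xV]] : exists x, ~ (x \in U -> x \in V) by apply/existsNP.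
have [[c xE]|[c ->]] := chain x y; last by rewrite rpredZ.
by case: xV; rewrite xE rpredZ.
Qed.

Lemma uniserial_indecomposable M :
  (exists x : M, x != 0) -> uniserial M -> indecomposable M.
Proof.
move=> nz uM; split=> // U V _ UV0.
by have [UV|VU] := uM U V; [left=> x xU | right=> x xV]; apply: UV0 => //;
  [apply: UV | apply: VU].
Qed.

(* The free module on the set [P]; [{malg A[P]}] is not available, as it requires
   [A] to be nontrivial. *)
Definition fin_supp P : {pred (P -> A^o)} :=
  fun f => `[< exists s : {fset P}, forall p, p \notin s -> f p = 0 >].

Fact fin_supp_closed P : submod_closed (@fin_supp P).
Proof.
split=> [|c f g /asboolP[s sP] /asboolP[t tP]]; apply/asboolP.
  by exists fset0.
exists (s `|` t)%fset => p; rewrite in_fsetU negb_or => /andP[ps pt].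
by rewrite -[LHS]/(c *: f p + g p) sP // tP // scaler0 addr0.
Qed.
HB.instance Definition _ P :=
  GRing.isSubmodClosed.Build A (P -> A^o) (@fin_supp P) (@fin_supp_closed P).

Definition fin_comb P (f : submodule (@fin_supp P)) : P :=
  \sum_(p \in [set: P]) (val f p : A) *: p.

Lemma fin_combE P (f : submodule (@fin_supp P)) (s : {fset P}) :
  (forall p, p \notin s -> val f p = 0) ->
  fin_comb f = \sum_(p <- s) (val f p : A) *: p.
Proof. by move=> fs; apply: fsbigTE => p /fs ->; rewrite scale0r. Qed.

Fact fin_comb_linear P : linear (@fin_comb P).
Proof.
move=> c f g; have /asboolP[s sP] := valP f; have /asboolP[t tP] := valP g.
have sU p : p \notin (s `|` t)%fset -> p \notin s /\ p \notin t.
  by rewrite in_fsetU negb_or => /andP.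
rewrite !(@fin_combE _ _ (s `|` t)%fset); last first.
- move=> p /sU[ps pt]; rewrite -[LHS]/(c *: val f p + val g p).
  by rewrite sP // tP // scaler0 addr0.
- by move=> p /sU[ps pt]; rewrite sP.
- by move=> p /sU[ps pt]; rewrite tP.
rewrite scaler_sumr -big_split; apply: eq_bigr => p _ /=.
by rewrite scalerA -scalerDl.
Qed.
HB.instance Definition _ P :=
  GRing.isLinear.Build A (submodule (@fin_supp P)) P *:%R (@fin_comb P)
    (@fin_comb_linear P).

(** Dual basis lemma: [phi p] is the coordinate at [p] of a splitting of the canonical map from the
    free module on [P] onto [P]. *)
Lemma projective_dual_basis P : projective P ->
  exists phi : P -> {linear P -> A^o},
    forall x, exists s : seq P, x = \sum_(p <- s) (phi p x : A) *: p.
Proof.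
move=> projP.
have surj (y : P) : exists x : submodule (@fin_supp P), fin_comb x = y.
  have yF : (fun p => (p == y)%:R : A^o) \in (@fin_supp P : submodClosed _).
    apply/asboolP; exists [fset y]%fset => p.
    by rewrite in_fset1 => /negPf ->.
  exists (Submodule yF); rewrite (@fin_combE _ _ [fset y]%fset).
    by rewrite big_seq_fset1 /= eqxx scale1r.
  by move=> p; rewrite in_fset1 /= => /negPf ->.
have [h hP] := projP _ _ (@fin_comb P) (@idfun P) surj.
have lin p : linear (fun x => val (h x) p : A^o).
  by move=> c x y /=; rewrite linearP.
pose phi p : {linear P -> A^o} := HB.pack (fun x => val (h x) p : A^o)
  (GRing.isLinear.Build A P A^o *:%R _ (lin p)).
exists phi => x.
have /asboolP[s sP] := valP (h x).
by exists s; rewrite -{1}[x]hP /= (fin_combE sP).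
Qed.

End Modules.

(** * Runs of consecutive arrows *)

Section Occurrences.
Variable G : brauer_config.
Local Notation next := (@anext G).

(** The length of $C^\mu$ for the special cycle $C$ at [a]; a run of this length is called full
    below. *)
Definition run_len (a : barrow G) : nat := valency (avertex a) * mu (avertex a).

Lemma anext_inj : injective next.
Proof.
move=> [[x i] xi] [[y j] yj] /(congr1 val) /= E.
have xy : x = y by have := congr1 (@tag _ _) E.
move: j yj E; case: y / xy => j yj /= /eqP; rewrite eq_Tagged /= => /eqP /perm_inj ij.
by rewrite /aocc /= in ij; apply: val_inj; rewrite /= ij.
Qed.

Lemma card_occurrence (x : vertex G) :
  #|{: occurrence_in (@polygon G) x}| = valency x.
Proof.
rewrite card_tagged sumnE big_map big_enum /=; apply: eq_bigr => V _.
by rewrite card_ord.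
Qed.

Lemma avertex_iter k (a : barrow G) : avertex (iter k next a) = avertex a.
Proof. by elim: k => // k IH; rewrite -[RHS]IH. Qed.

Lemma run_len_iter k (a : barrow G) : run_len (iter k next a) = run_len a.
Proof. by rewrite /run_len avertex_iter. Qed.

(** The orientation has a single cycle, so the orbit of an occurrence has all [valency] elements. *)
Lemma iter_valency (a : barrow G) : iter (valency (avertex a)) next a = a.
Proof.
(* [anext] keeps the vertex, so its iterates are those of one permutation on the fibre over
   [avertex a]. *)
have iterE k : val (iter k next a) =
    Tagged (fun x => occurrence_in (@polygon G) x)
      (iter k (orient (avertex a)) (aocc a)).
  elim: k => [|k IH]; first by case: (a) => [[]].
  move: IH; rewrite !iterS; case: (iter k _ a) => [[x i] xi] /= E.
  have xy : x = avertex a by have := congr1 (@tag _ _) E.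
  move: E; move: (iter k _ _) => j; case: _ / xy j => j /eqP.
  by rewrite eq_Tagged /= => /eqP ->.
apply: val_inj; rewrite iterE.
have -> : valency (avertex a) = #|porbit (orient (avertex a)) (aocc a)|.
  by rewrite -card_occurrence; apply: eq_card => i; rewrite orient_cyclic inE.
by rewrite iter_porbit; case: (a) => [[]].
Qed.

Lemma iter_run_len (a : barrow G) : iter (run_len a) next a = a.
Proof.
rewrite /run_len mulnC; elim: (mu _) => // m IH.
by rewrite mulSn addnC iterD iter_valency.
Qed.

Lemma valency_gt0 (a : barrow G) : 0 < valency (avertex a).
Proof.
by rewrite -card_occurrence; apply/card_gt0P; exists (aocc a).
Qed.

(** Arrows exist only at nontruncated vertices. *)
Lemma run_len_gt1 (a : barrow G) : 1 < run_len a.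
Proof.
rewrite ltn_neqAle eq_sym; have := svalP a; rewrite /truncated /run_len => -> /=.
by rewrite muln_gt0 valency_gt0 mu_gt0.
Qed.

Lemma fpath_cat_mid (T : eqType) (f : T -> T) (x y z : T) n s t :
  s ++ [:: x; y] ++ t = traject f z n -> y = f x.
Proof.
case: n s => [|n] [|w s] //= [xz E]; have := fpath_traject f z n.
  by rewrite -E xz => /andP[/eqP].
by rewrite -E cat_path => /and4P[_ _ /eqP].
Qed.

Lemma infix_special_cycle (a b c : barrow G) :
  infix [:: a; b] (special_cycle c) -> b = anext a.
Proof. by case/infixP => s [t E]; apply/fpath_cat_mid/esym/E. Qed.

Lemma anext_infix (a : barrow G) : 1 < valency (avertex a) ->
  infix [:: a; anext a] (special_cycle a).
Proof.
rewrite /special_cycle; case: valency => [|[|n]] // _.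
by apply/infixP; exists [::], (traject next (next (next a)) n).
Qed.

(** The inner run lies at the same vertex as the outer one, so it has the same length and leaves no
    room for [s] and [t]. *)
Lemma run_infix (a b : barrow G) s t :
  s ++ traject next b (run_len b) ++ t = traject next a (run_len a) ->
  [/\ s = [::], t = [::] & b = a].
Proof.
move=> E; have b_in : b \in traject next a (run_len a).
  by rewrite -E !mem_cat; case: run_len (run_len_gt1 b) => //= n _;
     rewrite inE eqxx orbT.
have [k _ bE] := trajectP b_in; have lenE : run_len b = run_len a.
  by rewrite bE run_len_iter.
have := congr1 size E; rewrite !size_cat !size_traject lenE => /eqP.
rewrite addnCA -[X in _ == X]addn0 eqn_add2l addn_eq0 !size_eq0.
case/andP => /eqP s0 /eqP t0; split => //.
move: E; rewrite s0 t0 /= cats0 lenE.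
by case: run_len (run_len_gt1 a) => // n _ [].
Qed.

(** A full run is determined by a nonempty tail: the lengths agree, so the arrows at position [k] of
    the full runs from [a] and from [c] coincide, and [next] is injective. *)
Lemma run_tail_eq (a b c : barrow G) s k : 0 < k < run_len a ->
  b :: s ++ traject next (iter k next a) (run_len a - k)
    = traject next c (run_len c) -> b = a.
Proof.
case/andP=> k0 ka E; set r := traject _ _ _ in E.
have hd : iter k next a \in b :: s ++ r.
  rewrite inE mem_cat /r -subn_gt0 in ka *.
  by case: (_ - k) ka => // n _; rewrite /= inE eqxx !orbT.
have [j _ aE] : exists2 j, j < run_len c & iter k next a = iter j next c.
  by apply/trajectP; rewrite -E.
have lenE : run_len a = run_len c.
  by rewrite -(run_len_iter k a) aE run_len_iter.
have szE : (size s).+1 = k.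
  move: (congr1 size E); rewrite /= size_cat !size_traject -lenE => Es.
  by apply: (@addIn (run_len a - k)); rewrite subnKC ?(ltnW ka) // -Es.
have hdE : iter k next a = iter k next c.
  have : nth c (b :: s ++ r) k = iter k next c by rewrite E nth_traject -?lenE.
  rewrite -cat_cons nth_cat /= szE ltnn subnn /r.
  by move: ka; rewrite -subn_gt0; case: (_ - k).
have ac : a = c.
  by elim: (k) hdE => // n IH; rewrite !iterS => /anext_inj.
by move: E; rewrite -ac; case: run_len (run_len_gt1 a) => // n _ [].
Qed.
End Occurrences.

(** * Path algebras *)

Section PathRing.
Local Open Scope ring_scope.
Variables (Q : quiver) (K : fieldType).

(* An interface to [path_alg]: unification unfolds the carrier [{malg _}] at
   each failed comparison of path algebra elements, so that computations are
   only practical over an abstract carrier. *)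
Record path_ring := PathRing {
  path_ring_sort :> pzRingType;
  pscale : K -> path_ring_sort -> path_ring_sort;
  pelt : qpath Q -> path_ring_sort;
  pcoef : qpath Q -> path_ring_sort -> K;
  pmulr_lin : forall g c f1 f2,
    (pscale c f1 + f2) * g = pscale c (f1 * g) + f2 * g;
  pmull_lin : forall f c g1 g2,
    f * (pscale c g1 + g2) = pscale c (f * g1) + f * g2;
  pmul_elt : forall p q, pelt p * pelt q = oapp pelt 0 (path_cat p q);
  pone_elt : 1 = \sum_v pelt (path_nil v);
  pelt_ind : forall P : path_ring_sort -> Prop,
    P 0 -> (forall c p f, P f -> P (pscale c (pelt p) + f)) -> forall f, P f;
  pcoef0 : forall p, pcoef p 0 = 0;
  pcoef_lin : forall p c f g,
    pcoef p (pscale c f + g) = c * pcoef p f + pcoef p g;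
  pcoef_elt : forall p q, pcoef p (pelt q) = (q == p)%:R;
  pscale1 : forall f, pscale 1 f = f;
  pscaleDl : forall c d f, pscale (c + d) f = pscale c f + pscale d f;
  pscaleA : forall c d f, pscale c (pscale d f) = pscale (c * d) f }.

Section PathAlg.
Local Notation KQ := (path_alg Q K).

Definition path_alg_scale c (f : KQ) : KQ := c *: f.

Fact path_alg_mulr_lin (g : KQ) c f1 f2 :
  (path_alg_scale c f1 + f2) * g = path_alg_scale c (f1 * g) + f2 * g.
Proof. exact: path_mul_linearl. Qed.

Fact path_alg_mull_lin (f : KQ) c g1 g2 :
  f * (path_alg_scale c g1 + g2) = path_alg_scale c (f * g1) + f * g2.
Proof. exact: path_mul_linearr. Qed.

Fact path_alg_ind (P : KQ -> Prop) :
  P 0 -> (forall c p f, P f -> P (path_alg_scale c (path_elt K p) + f)) -> forall f, P f.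
Proof.
move=> P0 PS f; rewrite [f]path_algE /path_lin.
by elim/big_rec: _ => // p g _; apply: PS.
Qed.

Fact path_alg_mcoeff_lin (p : qpath Q) c (f g : KQ) :
  mcoeff p (path_alg_scale c f + g) = c * mcoeff p f + mcoeff p g.
Proof. by rewrite mcoeffD mcoeffZ. Qed.

Fact path_alg_mcoeff_elt (p q : qpath Q) : mcoeff p (path_elt K q) = (q == p)%:R.
Proof. exact: mcoeffU. Qed.

Fact path_alg_scaleDl c d (f : KQ) :
  path_alg_scale (c + d) f = path_alg_scale c f + path_alg_scale d f.
Proof. exact: scalerDl. Qed.

Fact path_alg_scaleA c d (f : KQ) :
  path_alg_scale c (path_alg_scale d f) = path_alg_scale (c * d) f.
Proof. exact: scalerA. Qed.

Definition path_alg_ring : path_ring :=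
  @PathRing KQ path_alg_scale (@path_elt Q K) (fun p f => mcoeff p f)
    path_alg_mulr_lin path_alg_mull_lin (@path_mulE Q K) erefl path_alg_ind
    (@mcoeff0 _ K) path_alg_mcoeff_lin path_alg_mcoeff_elt (@scale1r K KQ)
    path_alg_scaleDl path_alg_scaleA.
End PathAlg.

Variable X : path_ring.
Implicit Types (p q r : qpath Q) (f g : X) (c : K).
Local Notation elt := (@pelt X).

Lemma pscale0 f : pscale 0 f = 0.
Proof. by apply: (@addIr _ (pscale 0 f)); rewrite -pscaleDl addr0 add0r. Qed.

Lemma pscaleN1 f : pscale (-1) f = - f.
Proof.
by apply: (@addIr _ f); rewrite -{2}[f]pscale1 -pscaleDl !addNr pscale0.
Qed.

Lemma pscaleE c f : pscale c f = pscale c 1 * f.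
Proof.
by have := pmulr_lin f c 1 0; rewrite addr0 mul1r mul0r addr0 => ->.
Qed.

Lemma pscale_comm c f : pscale c 1 * f = f * pscale c 1.
Proof.
have := pmull_lin f c 1 0; rewrite addr0 mulr1 mulr0 addr0 => ->.
by rewrite -pscaleE.
Qed.

Variant path_mul_spec p q : X -> Type :=
| PathMul r of path_tgt p = path_src q & path_val r = (path_src p, p.2 ++ q.2)
  : path_mul_spec p q (elt r)
| PathMul0 of path_tgt p <> path_src q : path_mul_spec p q 0.

Lemma path_mulP p q : path_mul_spec p q (elt p * elt q).
Proof.
by rewrite pmul_elt; case: path_catP => /= [r|]; constructor.
Qed.

Lemma path_mul_elt p q r : path_tgt p = path_src q ->
  path_val r = (path_src p, p.2 ++ q.2) -> elt p * elt q = elt r.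
Proof.
move=> pq rE; case: path_mulP => [s _ sE|/(_ pq)//].
by congr pelt; apply: val_inj; apply: etrans sE (esym rE).
Qed.

Definition aug (v : qvertex Q) f : K := pcoef (path_nil v) f.

Lemma aug_linear v c f g : aug v (pscale c f + g) = c * aug v f + aug v g.
Proof. exact: pcoef_lin. Qed.

Lemma aug0 v : aug v 0 = 0. Proof. exact: pcoef0. Qed.

Lemma aug_elt v p : aug v (elt p) = (p == path_nil v)%:R.
Proof. exact: pcoef_elt. Qed.

(** A product of two paths is the trivial path at [v] only if both factors are. *)
Lemma augM v f g : aug v (f * g) = aug v f * aug v g.
Proof.
elim/pelt_ind: f => [|c p f IHf]; first by rewrite mul0r aug0 mul0r.
rewrite pmulr_lin !aug_linear {}IHf mulrDl; congr (_ + _).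
rewrite -mulrA; congr (_ * _).
elim/pelt_ind: g => [|d q g IHg]; first by rewrite mulr0 aug0 mulr0.
rewrite pmull_lin !aug_linear {}IHg mulrDr; congr (_ + _).
rewrite mulrCA; congr (_ * _); rewrite !aug_elt -natrM mulnb.
have nilE r w : (r == path_nil w) = (path_src r == w) && nilp r.2.
  rewrite -val_eqE [val r]surjective_pairing /path_src xpair_eqE /=.
  by case: (path_val r).2.
case: path_mulP => [r pq rE|pq].
  rewrite aug_elt; congr (nat_of_bool _)%:R; rewrite !nilE -pq /path_src rE /=.
  rewrite /path_tgt /path_src; case: (path_val p) => u [|a s] //=.
    by rewrite andbT andbA andbb.
  by rewrite andbF.
rewrite aug0 (_ : _ && _ = false) //; apply/negbTE/negP => /andP[/eqP pv /eqP qv].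
by case: pq; rewrite pv qv.
Qed.

Lemma aug_arrow v a : aug v (elt (path_arrow a)) = 0.
Proof. by rewrite aug_elt -val_eqE xpair_eqE andbF. Qed.

Lemma augD v f g : aug v (f + g) = aug v f + aug v g.
Proof. by rewrite -[f]pscale1 aug_linear mul1r pscale1. Qed.

Lemma augN v f : aug v (- f) = - aug v f.
Proof. by rewrite -pscaleN1 -[pscale _ _]addr0 aug_linear aug0 addr0 mulN1r. Qed.

Lemma aug_ideal_gen (S : X -> Prop) v f :
  (forall g, S g -> aug v g = 0) -> ideal_gen S f -> aug v f = 0.
Proof.
move=> S0; elim=> {f} [f /S0 //||f g _ IHf _ IHg|f g _ IH|f g _ IH].
- exact: aug0.
- by rewrite augD IHf IHg addr0.
- by rewrite augM IH mulr0.
- by rewrite augM IH mul0r.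
Qed.

End PathRing.

(** * Runs as paths, and a linear form detecting the full runs *)

Section Runs.
Local Open Scope ring_scope.
Variables (K : fieldType) (G : brauer_config).
Variable KQ : path_ring (bquiver G) K.
Local Notation elt := (@pelt _ K KQ).
Local Notation next := (@anext G).
Local Notation src a := (tag (aocc a)).
Implicit Types (a b : barrow G) (p q : qpath (bquiver G)).

Fact walk_run a k : @walk (bquiver G) (src a) (traject next a k).
Proof.
by elim: k a => //= k IH a; rewrite eqxx; apply: (IH (next a)).
Qed.

Definition run a k : qpath (bquiver G) :=
  @QPath (bquiver G) (src a, traject next a k) (walk_run a k).

Lemma path_tgt_run a k : path_tgt (run a k) = src (iter k next a).
Proof.
rewrite /path_tgt /path_src /=; elim: k a => // k IH a.
by rewrite /= IH -iterSr.
Qed.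

Lemma run_mul a j k : elt (run a j) * elt (run (iter j next a) k) = elt (run a (j + k)).
Proof.
by apply: path_mul_elt; rewrite ?path_tgt_run //= trajectD.
Qed.

Lemma run1 a : elt (run a 1) = elt (path_arrow (a : qarrow (bquiver G))).
Proof. by congr elt; apply: val_inj. Qed.

Lemma prod_arrow_run a k :
  \prod_(b <- traject next a k.+1) elt (path_arrow (b : qarrow (bquiver G)))
  = elt (run a k.+1).
Proof.
elim: k a => [|k IH] a; first by rewrite big_seq1 run1.
by rewrite trajectS big_cons IH -run1 (run_mul a 1).
Qed.

Lemma special_cycle_pow a :
  (\prod_(b <- special_cycle a) elt (path_arrow (b : qarrow (bquiver G))))
    ^+ mu (avertex a) = elt (run a (run_len a)).
Proof.
rewrite /run_len /special_cycle mulnC.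
have -> : \prod_(b <- traject next a (valency (avertex a)))
      elt (path_arrow (b : qarrow (bquiver G)))
    = elt (run a (valency (avertex a))).
  by rewrite -(prednK (valency_gt0 a)) prod_arrow_run.
case: (mu _) (mu_gt0 (avertex a)) => // m _; elim: m => [|m IH].
  by rewrite expr1 mul1n.
(* One turn of the special cycle returns to [a], where the next factor starts. *)
by rewrite exprS IH -[X in _ * elt (run X _)](iter_valency a) run_mul.
Qed.

(* Each [run a (run_len a)] is the power [C ^ mu] of the special cycle at [a];
   these powers at a common source are identified in the quotient, where they
   span the socle. *)
Definition socle_form (f : KQ) : K := \sum_a pcoef (run a (run_len a)) f.

Lemma socle_form_linear c f g :
  socle_form (pscale c f + g) = c * socle_form f + socle_form g.
Proof.
rewrite /socle_form mulr_sumr -big_split; apply: eq_bigr => a _.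
exact: pcoef_lin.
Qed.

Lemma socle_form0 : socle_form 0 = 0.
Proof. by rewrite /socle_form big1 // => a _; exact: pcoef0. Qed.

Lemma socle_form_run a : socle_form (elt (run a (run_len a))) = 1.
Proof.
rewrite /socle_form (bigD1 a) //= pcoef_elt eqxx big1 ?addr0 // => b ba.
rewrite pcoef_elt; case: eqP => // /(congr1 val) /= E.
have := run_len_gt1 a; have := run_len_gt1 b; have := congr1 snd E => /=.
by case: run_len => // n; case: run_len => //= m [ab]; rewrite ab eqxx in ba.
Qed.

Lemma socle_form_eq0 p : (forall a, p.2 <> traject next a (run_len a)) ->
  socle_form (elt p) = 0.
Proof.
move=> pa; rewrite /socle_form big1 // => a _; rewrite pcoef_elt.
by case: eqP => // pE; case: (pa a); rewrite pE.
Qed.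

(** By [run_infix] a full run is no proper subpath of a full run, so only trivial factors
    contribute. The value depends on [a] through its source alone, so the form vanishes on type one
    relations. *)
Lemma socle_form_cycle a p q :
  socle_form (elt p * elt (run a (run_len a)) * elt q)
  = ((p == path_nil (src a : qvertex (bquiver G)))
     && (q == path_nil (src a : qvertex (bquiver G))))%:R.
Proof.
case: andP => [[/eqP-> /eqP->]|pq]; last first.
- case: path_mulP => [r pr rE|_]; last by rewrite mul0r socle_form0.
  case: path_mulP => [s rq sE|_]; last by rewrite socle_form0.
  apply: socle_form_eq0 => b; rewrite sE rE /= -catA => /run_infix[p0 q0 _].
  have nilE (r' : qpath (bquiver G)) : r'.2 = [::] -> r' = path_nil (path_src r').
    by move=> r0; apply: val_inj; rewrite /= [val r']surjective_pairing /= r0.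
  have ps : path_src p = src a.
    by rewrite -[LHS]/(path_tgt (path_nil (path_src p))) -(nilE p p0) pr.
  have qs : path_src q = src a.
    rewrite -rq /path_tgt /path_src rE p0 ps.
    by have := path_tgt_run a (run_len a); rewrite iter_run_len.
  by case: pq; rewrite (nilE p p0) (nilE q q0) ps qs.
rewrite (@path_mul_elt _ _ _ _ _ (run a (run_len a))) //.
rewrite (@path_mul_elt _ _ _ _ _ (run a (run_len a))) ?socle_form_run //.
  by rewrite path_tgt_run iter_run_len.
by rewrite /= cats0.
Qed.

Lemma socle_form_pathwise (y : KQ) :
  (forall p q, socle_form (elt p * y * elt q) = 0) ->
  forall f g, socle_form (f * y * g) = 0.
Proof.
move=> y0 f g; elim/pelt_ind: f => [|c p f IHf].
  by rewrite !mul0r socle_form0.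
rewrite !pmulr_lin socle_form_linear IHf addr0.
apply/eqP; rewrite mulf_eq0; apply/orP; right; apply/eqP.
elim/pelt_ind: g {IHf} => [|d q g IHg]; first by rewrite mulr0 socle_form0.
by rewrite pmull_lin socle_form_linear IHg addr0 y0 mulr0.
Qed.

Lemma socle_form_rel1 a b (f g : KQ) : src a = src b ->
  socle_form (f * (elt (run a (run_len a)) - elt (run b (run_len b))) * g) = 0.
Proof.
move=> ab; apply: (@socle_form_pathwise (_ - _)) => p q.
rewrite mulrBr mulrBl addrC -pscaleN1 socle_form_linear.
by rewrite !socle_form_cycle ab mulN1r addNr.
Qed.

(** $C^\mu a$ properly contains a full run, so no path through it is a full run. *)
Lemma socle_form_rel2 a (f g : KQ) :
  socle_form (f * (elt (run a (run_len a))
                   * elt (path_arrow (a : qarrow (bquiver G)))) * g) = 0.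
Proof.
apply: socle_form_pathwise => p q.
rewrite -run1 -[X in elt (run X 1)]iter_run_len run_mul.
case: path_mulP => [r pr rE|_]; last by rewrite mul0r socle_form0.
case: path_mulP => [s rq sE|_]; last by rewrite socle_form0.
apply: socle_form_eq0 => b; rewrite sE rE /= trajectD -!catA iter_run_len.
by case/run_infix.
Qed.

Lemma socle_form_rel3 a b (f g : KQ) : b <> next a ->
  socle_form (f * (elt (path_arrow (a : qarrow (bquiver G)))
                   * elt (path_arrow (b : qarrow (bquiver G)))) * g) = 0.
Proof.
move=> ba; apply: socle_form_pathwise => p q.
case: (path_mulP _ (path_arrow _)) => [r _ rE|_];
  last by rewrite mulr0 mul0r socle_form0.
case: path_mulP => [s pr sE|_]; last by rewrite mul0r socle_form0.
case: path_mulP => [t sq tE|_]; last by rewrite socle_form0.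
apply: socle_form_eq0 => c; rewrite tE sE rE /= -catA.
by move/fpath_cat_mid.
Qed.

Lemma socle_form_ideal_gen (S : KQ -> Prop) f :
  (forall x, S x -> forall g h, socle_form (g * x * h) = 0) ->
  ideal_gen S f -> socle_form f = 0.
Proof.
move=> S0 fI; suff : forall g h, socle_form (g * f * h) = 0.
  by move/(_ 1 1); rewrite mul1r mulr1.
elim: fI => {f} [f /S0 //|g h|x y _ IHx _ IHy g h|x y _ IH g h|x y _ IH g h].
- by rewrite mulr0 mul0r socle_form0.
- rewrite mulrDr mulrDl -[X in X + _]pscale1 socle_form_linear.
  by rewrite IHx IHy mulr0 addr0.
- by rewrite mulrA IH.
- by rewrite mulrA -mulrA IH.
Qed.

(** If the valency exceeds 1, the pair of [a] and [next a] lies in the special cycle at [a].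
    Otherwise [a] is a loop with $\mu > 1$, being nontruncated, and its square is the exception
    among type three relations. *)
Lemma rel3_neq_next a b :
  (forall c, ~~ infix [:: a; b] (special_cycle c)) ->
  ~ (a = b /\ valency (avertex a) = 1%N /\ (1 < mu (avertex a))%N) ->
  b <> next a.
Proof.
move=> ninf nloop bE; have := ninf a; rewrite bE.
have [|] := ltnP 1 (valency (avertex a)); first by move/anext_infix->.
move=> v_le1 _; have v1 : valency (avertex a) = 1%N.
  by apply/eqP; rewrite eqn_leq v_le1 valency_gt0.
have := iter_valency a; rewrite v1 /= => aE.
case: nloop; split; first by rewrite bE aE.
by split=> //; have := run_len_gt1 a; rewrite /run_len v1 mul1n.
Qed.

Lemma aug_run v a k : (0 < k)%N -> aug v (elt (run a k)) = 0.
Proof. by case: k => // k _; rewrite aug_elt -val_eqE xpair_eqE andbF. Qed.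

Lemma aug_rel1 v a b :
  aug v (elt (run a (run_len a)) - elt (run b (run_len b))) = 0.
Proof. by rewrite augD augN !aug_run ?subr0 // ltnW // run_len_gt1. Qed.

Lemma aug_arrow_mulr v (f : KQ) a :
  aug v (f * elt (path_arrow (a : qarrow (bquiver G)))) = 0.
Proof. by rewrite augM aug_arrow mulr0. Qed.

End Runs.

(** * The quotient algebra *)

Section BrauerRing.
Local Open Scope ring_scope.
Variables (K : fieldType) (G : brauer_config).
Local Notation src a := (tag (aocc a)).
Local Notation next := (@anext G).
Implicit Types (a b : barrow G) (p q : qpath (bquiver G)).

(* The corresponding interface to [brauer_alg]. *)
Record brauer_ring := BrauerRing {
  bpath : path_ring (bquiver G) K;
  bring :> pzRingType;
  bproj : {rmorphism bpath -> bring};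
  brepr : bring -> bpath;
  breprK : cancel brepr bproj;
  bproj_rel1 : forall a b, src a = src b ->
    bproj (pelt bpath (run a (run_len a))) = bproj (pelt bpath (run b (run_len b)));
  bproj_rel2 : forall a,
    bproj (pelt bpath (run a (run_len a))) * bproj (pelt bpath (run a 1)) = 0;
  bproj_rel3 : forall a b, b <> next a ->
    bproj (pelt bpath (run a 1)) * bproj (pelt bpath (run b 1)) = 0;
  baug_ker : forall v f, bproj f = 0 -> aug v f = 0;
  bform_ker : forall f, bproj f = 0 -> socle_form f = 0 }.

(** * Trivial paths, runs and the arrow ideal in the quotient *)

Variable B : brauer_ring.
Implicit Types (x y z : B) (c d : K) (v w : plabel G).
Local Notation KQ := (bpath B).
Local Notation pi := (@bproj B).
Local Notation elt := (@pelt _ _ KQ).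

Definition bidem v : B := pi (elt (path_nil (v : qvertex (bquiver G)))).
Definition brun a k : B := pi (elt (run a k)).
Definition bscalar c : B := pi (pscale c 1).
(** Independent of the representative, because [aug] vanishes on the kernel of [bproj]. *)
Definition baug v x : K := aug (v : qvertex (bquiver G)) (brepr x).

Lemma baug_proj v (f : KQ) : baug v (pi f) = aug (v : qvertex (bquiver G)) f.
Proof.
have /(baug_ker v) : pi (brepr (pi f) - f) = 0 by rewrite rmorphB breprK subrr.
by rewrite addrC -pscaleN1 aug_linear mulN1r addrC => /eqP; rewrite subr_eq0 => /eqP.
Qed.

Lemma baugD v x y : baug v (x + y) = baug v x + baug v y.
Proof.
rewrite -[x]breprK -[y]breprK -rmorphD !baug_proj.
by rewrite -[X in X + _]pscale1 aug_linear mul1r.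
Qed.

Lemma baugM v x y : baug v (x * y) = baug v x * baug v y.
Proof. by rewrite -[x]breprK -[y]breprK -rmorphM !baug_proj augM. Qed.

Lemma baug0 v : baug v 0 = 0.
Proof. by rewrite -(rmorph0 pi) baug_proj aug0. Qed.

Lemma baug_sum v (I : Type) (r : seq I) (P : pred I) (F : I -> B) :
  baug v (\sum_(i <- r | P i) F i) = \sum_(i <- r | P i) baug v (F i).
Proof. by elim/big_rec2: _ => [|i x y _ <-]; rewrite ?baug0 ?baugD. Qed.

Lemma baug_idem v w : baug v (bidem w) = (w == v)%:R.
Proof. by rewrite baug_proj aug_elt -val_eqE xpair_eqE andbT. Qed.

Lemma baug_run v a k : (0 < k)%N -> baug v (brun a k) = 0.
Proof. by rewrite baug_proj; apply: aug_run. Qed.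

Lemma one_bidem : 1 = \sum_v bidem v.
Proof. by rewrite -(rmorph1 pi) pone_elt rmorph_sum. Qed.

Lemma baug1 v : baug v 1 = 1.
Proof.
rewrite one_bidem baug_sum (bigD1 v) //= baug_idem eqxx big1 ?addr0 // => w wv.
by rewrite baug_idem (negPf wv).
Qed.

Lemma bscalar_scale c (f : KQ) : pi (pscale c f) = bscalar c * pi f.
Proof. by rewrite pscaleE rmorphM. Qed.

Lemma bscalarC c x : bscalar c * x = x * bscalar c.
Proof. by rewrite -[x]breprK -!rmorphM pscale_comm. Qed.

Lemma bscalarD c d : bscalar (c + d) = bscalar c + bscalar d.
Proof. by rewrite /bscalar pscaleDl rmorphD. Qed.

Lemma bscalarM c d : bscalar (c * d) = bscalar c * bscalar d.
Proof. by rewrite /bscalar -pscaleA bscalar_scale. Qed.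

Lemma bscalar0 : bscalar 0 = 0.
Proof. by rewrite /bscalar pscale0 rmorph0. Qed.

Lemma bscalar1 : bscalar 1 = 1.
Proof. by rewrite /bscalar pscale1 rmorph1. Qed.

Lemma baug_scalar v c : baug v (bscalar c) = c.
Proof.
rewrite baug_proj -[pscale c 1]addr0 aug_linear aug0 addr0.
by rewrite -(baug_proj v) rmorph1 baug1 mulr1.
Qed.

Lemma brun_mul a j k : brun a j * brun (iter j next a) k = brun a (j + k).
Proof. by rewrite -rmorphM run_mul. Qed.

Lemma bidem_mulR v a k : bidem v * brun a k = if v == src a then brun a k else 0.
Proof.
rewrite -rmorphM; case: eqP => [->|va].
  by congr (pi _); apply: path_mul_elt.
by case: path_mulP => [r /va|_] //; rewrite rmorph0.
Qed.

Lemma brun_mulE v a k :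
  brun a k * bidem v = if v == src (iter k next a) then brun a k else 0.
Proof.
rewrite -rmorphM; case: eqP => [->|va].
  by congr (pi _); apply: path_mul_elt; rewrite ?path_tgt_run //= cats0.
case: path_mulP => [r|_]; last by rewrite rmorph0.
by rewrite path_tgt_run => /esym/va.
Qed.

Lemma bidem_idem v : bidem v * bidem v = bidem v.
Proof. by rewrite -rmorphM; congr (pi _); apply: path_mul_elt. Qed.

Lemma bidem_orth v w : v != w -> bidem v * bidem w = 0.
Proof.
move=> vw; rewrite -rmorphM; case: path_mulP => [r /eqP|_].
  by rewrite (negPf vw).
by rewrite rmorph0.
Qed.

Lemma brun_step a b k : (0 < k)%N ->
  brun a k * brun b 1 = if b == iter k next a then brun a k.+1 else 0.
Proof.
case: k => // k _; case: eqP => [->|ba]; first by rewrite brun_mul addn1.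
by rewrite -addn1 -brun_mul -mulrA bproj_rel3 ?mulr0 // addn1.
Qed.

Lemma brun_gt a k : (run_len a < k)%N -> brun a k = 0.
Proof.
(* The first [run_len a] arrows return to [a], so the run begins with the type two relation $C^\mu
   a$. *)
move=> Nk; rewrite -(subnKC Nk) -brun_mul -addn1 -brun_mul iter_run_len.
by rewrite /brun bproj_rel2 mul0r.
Qed.

Lemma brun_socle a b : src a = src b -> brun a (run_len a) = brun b (run_len b).
Proof. exact: bproj_rel1. Qed.

Lemma bring_ind (P : B -> Prop) :
    P 0 -> (forall x y, P x -> P y -> P (x + y)) ->
    (forall c x, P x -> P (bscalar c * x)) ->
    (forall v, P (bidem v)) -> (forall a x, P x -> P (brun a 1 * x)) ->
  forall x, P x.
Proof.
move=> P0 PD Psc PE PR x; rewrite -[x]breprK.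
elim/pelt_ind: (brepr x) => [|c p f Pf]; first by rewrite rmorph0.
rewrite rmorphD bscalar_scale; apply: PD => //; apply: Psc => {c f Pf}.
have [n] := ubnP (size p.2); elim: n p => // n IH p.
have : walk (path_val p).1 (path_val p).2 := valP p.
case pE: (path_val p) => [v [|a s]].
  by move=> _ _; have -> : p = path_nil v; [apply: val_inj; apply: pE | apply: PE].
move=> /= /andP[/eqP av sw] sz; pose q := @QPath (bquiver G) (qtgt a, s) sw.
have -> : elt p = elt (run (a : barrow G) 1) * elt q.
  by apply/esym/path_mul_elt; rewrite ?path_tgt_run // pE /path_src /= -av.
by rewrite rmorphM; apply/PR/IH.
Qed.

Lemma bring_decomp x : exists l : barrow G -> B,
  x = \sum_v bscalar (baug v x) * bidem v + \sum_b brun b 1 * l b.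
Proof.
elim/bring_ind: x => [|x y [l {1}->] [m {1}->]|c x [l {1}->]|w|a x _].
- exists (fun=> 0); rewrite !big1 ?addr0 // => [b _|v _]; first by rewrite mulr0.
  by rewrite baug0 bscalar0 mul0r.
- exists (fun b => l b + m b); rewrite addrACA -!big_split; congr (_ + _).
    by apply: eq_bigr => v _; rewrite /= baugD bscalarD mulrDl.
  by apply: eq_bigr => b _; rewrite /= mulrDr.
- exists (fun b => l b * bscalar c); rewrite mulrDr !mulr_sumr; congr (_ + _).
    by apply: eq_bigr => v _; rewrite baugM baug_scalar bscalarM mulrA.
  by apply: eq_bigr => b _; rewrite bscalarC mulrA.
- exists (fun=> 0); rewrite [X in _ + X]big1 ?addr0 => [|b _]; last by rewrite mulr0.
  rewrite (bigD1 w) //= baug_idem eqxx bscalar1 mul1r big1 ?addr0 // => v vw.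
  by rewrite baug_idem eq_sym (negPf vw) bscalar0 mul0r.
- exists (fun b => if b == a then x else 0).
  rewrite big1 ?add0r => [|v _]; last by rewrite baugM baug_run // mul0r bscalar0 mul0r.
  by rewrite (bigD1 a) //= eqxx big1 ?addr0 // => b /negPf ->; rewrite mulr0.
Qed.

(* The [n]-th power of the ideal spanned by the paths of positive length. *)
Fixpoint arrow_ideal n x : Prop :=
  if n is n'.+1 then
    exists l : barrow G -> B,
      (forall b, arrow_ideal n' (l b)) /\ x = \sum_b brun b 1 * l b
  else True.

Lemma arrow_ideal0 n : arrow_ideal n 0.
Proof.
elim: n => //= n IH; exists (fun=> 0); split=> //.
by rewrite big1 // => b _; rewrite mulr0.
Qed.

Lemma arrow_idealD n x y :
  arrow_ideal n x -> arrow_ideal n y -> arrow_ideal n (x + y).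
Proof.
elim: n x y => //= n IH x y [l [lJ ->]] [m [mJ ->]].
exists (fun b => l b + m b); split=> [b|]; first exact: IH.
by rewrite -big_split; apply: eq_bigr => b _; rewrite mulrDr.
Qed.

Lemma arrow_ideal_sum n (I : Type) (r : seq I) (P : pred I) (F : I -> B) :
  (forall i, P i -> arrow_ideal n (F i)) ->
  arrow_ideal n (\sum_(i <- r | P i) F i).
Proof.
move=> FJ; elim/big_rec: _ => [|i x Pi xJ]; first exact: arrow_ideal0.
exact: arrow_idealD (FJ i Pi) xJ.
Qed.

Lemma arrow_idealMr n x y : arrow_ideal n x -> arrow_ideal n (x * y).
Proof.
elim: n x => //= n IH x [l [lJ ->]]; exists (fun b => l b * y); split=> [b|].
  exact: IH.
by rewrite mulr_suml; apply: eq_bigr => b _; rewrite mulrA.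
Qed.

Lemma arrow_idealS n x : arrow_ideal n.+1 x -> arrow_ideal n x.
Proof.
elim: n x => // n IH x [l [lJ ->]]; exists l; split=> // b; exact: IH.
Qed.

Lemma arrow_ideal_arrow n a x : arrow_ideal n x -> arrow_ideal n.+1 (brun a 1 * x).
Proof.
move=> xJ; exists (fun b => if b == a then x else 0); split=> [b|].
  by case: eqP => // _; apply: arrow_ideal0.
by rewrite (bigD1 a) //= eqxx big1 ?addr0 // => b /negPf ->; rewrite mulr0.
Qed.

(** On the left, an idempotent keeps or kills each leading arrow, and an arrow leads into the next
    power. *)
Lemma arrow_idealMl n x y : arrow_ideal n y -> arrow_ideal n (x * y).
Proof.
elim/bring_ind: x y => [y _|x1 x2 IH1 IH2 y yJ|c x IH y yJ|v y|a x IH y yJ].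
- by rewrite mul0r; apply: arrow_ideal0.
- by rewrite mulrDl; apply: arrow_idealD; [apply: IH1 | apply: IH2].
- by rewrite -mulrA bscalarC; apply/arrow_idealMr/IH.
- case: n => [//|n] [l [lJ ->]]; rewrite mulr_sumr; apply: arrow_ideal_sum => b _.
  rewrite mulrA bidem_mulR; case: eqP => _; first exact/arrow_ideal_arrow/lJ.
  by rewrite mul0r; apply: arrow_ideal0.
- by rewrite -mulrA; apply: arrow_idealS (arrow_ideal_arrow a (IH y yJ)).
Qed.

Lemma arrow_idealM m n x y :
  arrow_ideal m x -> arrow_ideal n y -> arrow_ideal (m + n) (x * y).
Proof.
elim: m x => [|m IH] x /=; first by move=> _; apply: arrow_idealMl.
case=> l [lJ ->] yJ; rewrite mulr_suml; apply: (@arrow_ideal_sum _.+1) => b _.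
by rewrite -mulrA; apply: arrow_ideal_arrow; apply: IH.
Qed.

Lemma arrow_idealX n x : arrow_ideal 1 x -> arrow_ideal n (x ^+ n).
Proof.
move=> xJ; elim: n => [|n IH]; first by [].
rewrite exprS.
exact: (@arrow_idealM 1 n x _ xJ IH).
Qed.

(** Of the leading arrows in [x], only the one continuing the run can give a nonzero product. *)
Lemma brun_arrow_ideal a k n x : (0 < k)%N -> arrow_ideal n x ->
  exists y, brun a k * x = brun a (k + n) * y.
Proof.
elim: n k x => [|n IH] k x k0; first by exists x; rewrite addn0.
case=> l [lJ ->]; have [//|y yE] := IH k.+1 (l (iter k next a)) _ (lJ _).
exists y; rewrite addnS -yE mulr_sumr (bigD1 (iter k next a)) //= mulrA.
rewrite brun_step // eqxx big1 ?addr0 // => b /negPf bk.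
by rewrite mulrA brun_step // bk mul0r.
Qed.

(** Exceeds the length of every nonzero run, so this power of the arrow ideal is zero. *)
Definition nil_index : nat := (\max_(b : barrow G) run_len b).+1.

Lemma arrow_ideal_nil x : arrow_ideal nil_index x -> x = 0.
Proof.
case=> l [lJ ->]; rewrite big1 // => b _.
have [//|y ->] := @brun_arrow_ideal b 1 _ _ _ (lJ b).
by rewrite brun_gt ?mul0r // ltnS leq_bigmax.
Qed.

Lemma aug0_arrow_ideal x : (forall v, baug v x = 0) -> arrow_ideal 1 x.
Proof.
move=> x0; have [l {1}->] := bring_decomp x; rewrite big1 ?add0r => [|v _].
  by exists l.
by rewrite x0 bscalar0 mul0r.
Qed.

(** With $m = -n c^{-1}$ nilpotent, $(c + n) c^{-1} = 1 - m$ is inverted by a finite geometric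
    series. *)
Lemma arrow_ideal_unit c n : c != 0 -> arrow_ideal 1 n ->
  exists u, (bscalar c + n) * u = 1.
Proof.
move=> c0 nJ; pose m := - (n * bscalar c^-1).
have mJ : arrow_ideal 1 m.
  by rewrite /m -mulrN; apply: arrow_idealMr.
exists (bscalar c^-1 * \sum_(i < nil_index) m ^+ i).
rewrite mulrA mulrDl -bscalarM divff // bscalar1.
have := subrX1 m nil_index; rewrite (arrow_ideal_nil (arrow_idealX _ mJ)) sub0r.
by move/(congr1 -%R); rewrite opprK -mulNr opprB /m opprK.
Qed.

(** Induction on $N + 1 - k$, where $N$ is [run_len a]. If [x] has coefficient 0 at the end vertex
    of the run, only its part in the arrow ideal acts, and this prolongs the run; otherwise [x] acts
    on the run as a unit. *)
Lemma brun_mul_cases a k x : (0 < k)%N ->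
  brun a k * x = 0 \/
  exists j u u', [/\ (k <= j <= run_len a)%N, brun a k * x = brun a j * u & u * u' = 1].
Proof.
have [n] := ubnP ((run_len a).+1 - k); elim: n k x => // n IH k x nk k0.
have [kN|/brun_gt ->] := leqP k (run_len a); last by left; rewrite mul0r.
have [l lE] := bring_decomp x; set c := baug (src (iter k next a)) x.
set y := \sum_b brun b 1 * l b in lE.
have kE : brun a k * x = bscalar c * brun a k + brun a k * y.
  rewrite lE mulrDr; congr (_ + _); rewrite mulr_sumr.
  rewrite (bigD1 (src (iter k next a))) //= big1 ?addr0 => [|v vk].
    by rewrite mulrA -bscalarC -mulrA brun_mulE eqxx.
  by rewrite mulrA -bscalarC -mulrA brun_mulE (negPf vk) mulr0.
have yJ : arrow_ideal 1 y by exists l; split.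
have [c0|c0] := eqVneq c 0.
  have [z zE] := @brun_arrow_ideal a _ _ _ k0 yJ.
  rewrite kE c0 bscalar0 mul0r add0r zE addn1.
  have [] := IH k.+1 z _ isT; first by rewrite subSS -ltnS -subSn.
    by left.
  by case=> j [u [u' [/andP[kj jN] uE uu']]]; right; exists j, u, u'; rewrite (ltnW kj).
(* [x] may have coefficient 0 at other trivial paths, but it acts on the run like $c + y$, whose
   coefficient is $c$ at all of them. *)
have [u' uu'] := arrow_ideal_unit c0 yJ; right.
by exists k, (bscalar c + y), u'; rewrite leqnn kN mulrDr -bscalarC.
Qed.

Definition bform x : K := socle_form (brepr x).

Lemma bform_proj (f : KQ) : bform (pi f) = socle_form f.
Proof.
have /bform_ker : pi (brepr (pi f) - f) = 0 by rewrite rmorphB breprK subrr.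
by rewrite addrC -pscaleN1 socle_form_linear mulN1r addrC => /eqP;
  rewrite subr_eq0 => /eqP.
Qed.

Lemma brun_socle_neq0 a : brun a (run_len a) != 0.
Proof.
apply/eqP => /(congr1 bform).
rewrite -(rmorph0 pi) !bform_proj socle_form_run socle_form0 => /eqP.
by rewrite oner_eq0.
Qed.

(** Multiply by the run [r] completing [run a k] to a full run: the form is 1 on the left, and on
    the right it sees only full runs that start with [b] and end with [r], which by [run_tail_eq]
    requires [b] to be [a]. *)
Lemma brun_arrow_eq a b k x : (0 < k < run_len a)%N ->
  brun a k = brun b 1 * x -> b = a.
Proof.
move=> kN aE; apply: contrapT => ba; set r := run (iter k next a) (run_len a - k).
have form0 : bform (brun a k * pi (elt r)) = 0.
  rewrite aE -[x]breprK -!rmorphM bform_proj.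
  elim/pelt_ind: (brepr x) => [|c p f IH]; first by rewrite mulr0 mul0r socle_form0.
  rewrite pmull_lin pmulr_lin socle_form_linear IH addr0.
  case: path_mulP => [q _ qE|_]; last by rewrite mul0r socle_form0 mulr0.
  case: path_mulP => [s _ sE|_]; last by rewrite socle_form0 mulr0.
  rewrite socle_form_eq0 ?mulr0 // => e; rewrite sE qE /= => /(run_tail_eq kN).
  exact: ba.
have := socle_form_run KQ a; rewrite -bform_proj -/(brun a _).
case/andP: kN => _ /ltnW/subnKC <-; rewrite -brun_mul form0 => /eqP.
by rewrite eq_sym oner_eq0.
Qed.

End BrauerRing.

(** * Modules over the quotient algebra *)

Section RightAction.
Local Open Scope ring_scope.
Variables (A : pzRingType) (M : rmodType A).
Implicit Types (m n : M) (x y : A).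

Definition ract m x : M := (x : A^c) *: m.

Lemma ractA m x y : ract (ract m x) y = ract m (x * y).
Proof. by rewrite /ract scalerA. Qed.

Lemma ractDr m x y : ract m (x + y) = ract m x + ract m y.
Proof. exact: scalerDl. Qed.

Lemma ractBr m x y : ract m (x - y) = ract m x - ract m y.
Proof. exact: scalerBl. Qed.

Lemma ract0r m : ract m 0 = 0. Proof. exact: scale0r. Qed.
Lemma ract0l x : ract 0 x = 0. Proof. exact: scaler0. Qed.
Lemma ract1 m : ract m 1 = m. Proof. exact: scale1r. Qed.

Lemma ract_sum m (I : Type) (r : seq I) (P : pred I) (F : I -> A) :
  ract m (\sum_(i <- r | P i) F i) = \sum_(i <- r | P i) ract m (F i).
Proof. exact: (@scaler_suml A^c). Qed.

Lemma ract_sub (U : submodClosed M) m x : m \in U -> ract m x \in U.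
Proof. exact: rpredZ. Qed.

End RightAction.

Lemma ract_linear (A : pzRingType) (M N : rmodType A) (f : {linear M -> N}) m x :
  f (ract m x) = ract (f m) x.
Proof. exact: linearZ_LR. Qed.

(** * Modules isomorphic to $e_v\Lambda$, and the projective indecomposables *)

Section BrauerModules.
Local Open Scope ring_scope.
Variables (K : fieldType) (G : brauer_config) (B : brauer_ring K G).
Local Notation src a := (tag (aocc a)).
Local Notation next := (@anext G).
Local Notation E := (@bidem K G B).
Local Notation R := (@brun K G B).
Local Notation rmod := (rmodType (bring B)).
Implicit Types (v w : plabel G) (x y : B).

(** $e_v x = e_v (c + n)$, with $c$ the coefficient of $x$ at $e_v$ and $n$ in the arrow ideal, and
    $c + n$ has a right inverse. *)
Lemma corner_unit v x : baug v x != 0 -> exists y, E v * x * y = E v.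
Proof.
move=> c0; have [l lE] := bring_decomp x.
set n := \sum_b brun _ b 1 * l b in lE.
have [y yE] : exists y, (bscalar B (baug v x) + n) * y = 1.
  by apply: arrow_ideal_unit => //; exists l; split.
exists y; rewrite [X in _ * X * _]lE -[RHS]mulr1 -yE [RHS]mulrA; congr (_ * _).
rewrite !mulrDr; congr (_ + _).
rewrite mulr_sumr (bigD1 v) //= mulrA -bscalarC -mulrA bidem_idem.
rewrite big1 ?addr0 ?bscalarC //.
by move=> w wv; rewrite mulrA -bscalarC -mulrA bidem_orth ?mulr0 // eq_sym.
Qed.

(* [m] is the image of [e_v] under an isomorphism [e_v Lambda -> P]. *)
Definition corner_gen (P : rmod) v (m : P) : Prop :=
  [/\ ract m (E v) = m, forall p, exists x, p = ract m x
    & forall x, ract m x = 0 -> E v * x = 0].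

Section CornerGen.
Variables (P : rmod) (v : plabel G) (m : P).
Hypothesis mP : corner_gen v m.

Lemma corner_gen_eq x y : ract m x = ract m y -> E v * x = E v * y.
Proof.
case: mP => _ _ inj xy; apply/eqP; rewrite -subr_eq0 -mulrBr; apply/eqP/inj.
by rewrite ractBr xy subrr.
Qed.

Lemma corner_gen_aug x y : ract m x = ract m y -> baug v x = baug v y.
Proof.
by move/corner_gen_eq/(congr1 (baug v)); rewrite !baugM baug_idem eqxx !mul1r.
Qed.

(** The map sends $m x$ to $q x$, which depends only on $e_v x$ as $q = q e_v$. *)
Lemma corner_gen_lift (Q : rmod) (q : Q) : ract q (E v) = q ->
  exists h : {linear P -> Q}, h m = q.
Proof.
move=> qE; have [mE gen _] := mP; have [lam lamP] := choice gen.
have hE x p : p = ract m x -> ract q (lam p) = ract q x.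
  by move=> px; rewrite -qE !ractA (@corner_gen_eq (lam p) x) // -lamP.
have lin : linear (fun p => ract q (lam p)).
  move=> c p r; rewrite (@hE (lam p * (c : B) + lam r)).
    by rewrite ractDr -ractA.
  by rewrite ractDr -ractA -!lamP.
pose h : {linear P -> Q} := HB.pack (fun p => ract q (lam p))
  (GRing.isLinear.Build _ P Q *:%R _ lin).
by exists h; rewrite /= (hE 1) ract1.
Qed.

Lemma corner_gen_projective : projective P.
Proof.
move=> M N g f g_surj; have [mE gen _] := mP; have [n nE] := g_surj (f m).
(* The preimage $n$ of $f(m)$ is replaced by $n e_v$, still a preimage since $m e_v = m$. *)
have [|h hm] := @corner_gen_lift M (ract n (E v)).
  by rewrite ractA bidem_idem.
exists h => p; have [x ->] := gen p.
by rewrite /= !ract_linear hm ract_linear nE -ract_linear mE.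
Qed.

(** [P] is local: by [corner_unit], an element with nonzero coefficient at $e_v$ generates it. *)
Lemma corner_gen_full (U : submodClosed P) x :
  ract m x \in U -> baug v x != 0 -> forall p, p \in U.
Proof.
have [mE gen _] := mP; move=> xU /corner_unit[y yE] p; have [z ->] := gen p.
apply: ract_sub; rewrite -mE -yE -ractA -[ract m (_ * x)]ractA mE.
exact: ract_sub.
Qed.

Lemma corner_gen_neq0 : m != 0.
Proof.
apply/eqP => m0; have := @corner_gen_aug 1 0.
rewrite !m0 !ract0l baug1 baug0 => /(_ erefl)/eqP.
by rewrite oner_eq0.
Qed.

Lemma corner_gen_indecomposable : indecomposable P.
Proof.
have [mE gen _] := mP; split; first by exists m; apply: corner_gen_neq0.
move=> U V UV UV0; have [u [w [uU wV muw]]] := UV m.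
have [x xE] := gen u; have [y yE] := gen w.
(* One of the two components of $m$ has nonzero coefficient at $e_v$; the submodule containing it is
   everything, and the other is then zero. *)
have aug1 : baug v x + baug v y = 1.
  rewrite -baugD -(baug1 B v); apply: corner_gen_aug.
  by rewrite ractDr -xE -yE ract1.
have [x0|x0] := eqVneq (baug v x) 0.
  left=> p pU; apply: UV0 => //; apply: (@corner_gen_full _ y); first by rewrite -yE.
  by move: aug1; rewrite x0 add0r => ->; rewrite oner_eq0.
by right=> p pV; apply: UV0 => //; apply: (@corner_gen_full _ x); rewrite -?xE.
Qed.

(** From $m = m x e_w y$, the coefficient of $x e_w y$ at $e_v$ is 1, but it is 0 unless $w = v$. *)
Lemma corner_gen_uniq w (n : P) : corner_gen w n -> v = w.
Proof.
have [mE gen _] := mP; case=> nE gen' _.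
have [x xE] := gen n; have [y yE] := gen' m.
have : ract m 1 = ract m (x * E w * y).
  by rewrite ract1 -!ractA -xE nE.
move/corner_gen_aug; rewrite baug1 !baugM baug_idem; case: eqP => // _ /eqP.
by rewrite mulr0 mul0r oner_eq0.
Qed.

Lemma corner_gen_iso (Q : rmod) : isomorphic P Q -> exists n : Q, corner_gen v n.
Proof.
have [mE gen inj] := mP; case=> f [g fK gK]; exists (f m); split=> [|q|x].
- by rewrite -ract_linear mE.
- by have [x xE] := gen (g q); exists x; rewrite -(gK q) xE ract_linear.
- rewrite -ract_linear => fx0; apply: inj; apply: (can_inj fK).
  by rewrite fx0 linear0.
Qed.

End CornerGen.

Lemma corner_gen_isomorphic (P Q : rmod) v (m : P) (n : Q) :
  corner_gen v m -> corner_gen v n -> isomorphic P Q.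
Proof.
move=> mP nP; have [mE genm _] := mP; have [nE genn _] := nP.
have [f fm] := corner_gen_lift mP nE; have [g gn] := corner_gen_lift nP mE.
exists f; exists g => p.
  by have [x ->] := genm p; rewrite !ract_linear fm gn.
by have [x ->] := genn p; rewrite !ract_linear gn fm.
Qed.

Lemma projective_corner_gen (P : rmod) :
  projective P -> indecomposable P -> exists v (m : P), corner_gen v m.
Proof.
move=> projP [[x0 x0_neq0] indP]; have [phi phiP] := projective_dual_basis projP.
have phi_ract (p x : P) (c : B) : phi p (ract x c) = (phi p x : B) * c :> B.
  by rewrite (ract_linear (phi p)).
have [v [p [x px]]] : exists v (p x : P), baug v (phi p x : B) != 0.
  apply: contrapT => no; case/eqP: x0_neq0.
  (* If all coordinates take values in the arrow ideal, then $\phi_p(x) = \sum_q \phi_p(q)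
     \phi_q(x)$ puts them by induction in all its powers, so they vanish. *)
  have allJ n (p x : P) : arrow_ideal n (phi p x : B).
    elim: n p x => // n IH p x; have [s sE] := phiP x.
    rewrite {1}sE linear_sum; apply: (@arrow_ideal_sum _ _ _ n.+1) => q _.
    rewrite [phi p _]phi_ract; apply: (@arrow_idealM _ _ _ 1) (IH _ _).
    apply: aug0_arrow_ideal => v; apply: contrapT => /eqP pv.
    by case: no; exists v, p, q.
  have [s sE] := phiP x0; rewrite {1}sE big1 // => p _.
  by rewrite (arrow_ideal_nil (allJ (nil_index G) p x0)) scale0r.
have psi_lin : linear (fun z : P => E v * (phi p z : B) : (bring B)^c^o).
  by move=> c y z; rewrite linearP mulrDr mulrA.
pose psi : {linear P -> (bring B)^c^o} := HB.pack
  (fun z : P => E v * (phi p z : B) : (bring B)^c^o)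
  (GRing.isLinear.Build _ P (bring B)^c^o *:%R _ psi_lin).
(* Since $e_v \phi_p(x) e_v y = e_v$, [psi] sends $m = x e_v y e_v$ to $e_v$; the last factor
   ensures $m e_v = m$. *)
have [|y yE] := @corner_unit v ((phi p x : B) * E v).
  by rewrite baugM baug_idem eqxx mulr1.
pose m := ract x (E v * y * E v).
have psim : psi m = E v.
  by rewrite /psi /= /m phi_ract !mulrA -[E v * _ * E v]mulrA yE bidem_idem.
have psi_ract (z : P) (c : B) : psi (ract z c) = (psi z : B) * c :> B.
  by rewrite (ract_linear psi).
have psiE (z : P) : E v * (psi z : B) = psi z by rewrite /psi /= mulrA bidem_idem.
have mE : ract m (E v) = m by rewrite ractA -mulrA bidem_idem.
exists v, m; split=> // [z|z z0]; last first.
  by rewrite -psim -psi_ract z0 linear0.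
(* [P] is the direct sum of $m\Lambda$ and the kernel of [psi]; as $m \neq 0$, the kernel is
   zero. *)
have [||U0|V0] := indP (cyclic_submod m : submodClosed P)
                       (ker_submod psi : submodClosed P).
- move=> q; exists (ract m (psi q)), (q - ract m (psi q)).
  split; last by rewrite addrCA subrr addr0.
    by apply/cyclic_submodP; exists (psi q).
  by rewrite /ker_submod unfold_in linearB psi_ract psim psiE subrr.
- move=> q /cyclic_submodP[c ->]; rewrite -/(ract m c).
  rewrite /ker_submod unfold_in psi_ract psim => /eqP c0.
  by rewrite -mE ractA c0 ract0r.
- have m0 : m = 0 by apply: U0; apply/cyclic_submodP; exists 1; rewrite scale1r.
  have := baug_idem B v v; rewrite -psim m0 linear0 baug0 eqxx => /eqP.
  by rewrite eq_sym oner_eq0.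
- exists (psi z); apply/eqP; rewrite -subr_eq0; apply/eqP/V0.
  by rewrite /ker_submod unfold_in linearB psi_ract psim psiE subrr.
Qed.

(** * The radical as a sum of uniserial submodules *)

Section Radical.
Variables (P : rmod) (v : plabel G) (m : P).
Hypothesis mP : corner_gen v m.

(** An arrow starting at [v] is an occurrence in [v] of a nontruncated vertex; the arrows are
    grouped by this vertex. *)
Fact card_arrows_from :
  #|[pred a : barrow G | src a == v]| = nontruncated_count v.
Proof.
rewrite -sum1_card /nontruncated_count.
transitivity (\sum_(p : {x : vertex G & occurrence_in (@polygon G) x}
    | ~~ truncated (tag p) && (tag (tagged p) == v)) 1)%N.
  apply/esym; rewrite (reindex_omap (val : barrow G -> _) insub).
    by apply: eq_bigl => a; rewrite valK eqxx andbT (svalP a).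
  by move=> p /andP[pt _]; rewrite insubT.
rewrite -(@sig_big_dep _ _ _ _ _ (fun x : vertex G => ~~ truncated x)
  (fun (x : vertex G) (o : occurrence_in (@polygon G) x) => tag o == v) (fun _ _ => 1%N)).
apply: eq_bigr => x _.
transitivity (\sum_(V | V == v) \sum_(i : 'I_(polygon V x) | true) 1)%N.
  by rewrite sig_big_dep; apply: eq_bigl => o; rewrite andbT.
by rewrite big_pred1_eq sum1_card card_ord.
Qed.

Definition arrow_from (i : 'I_(nontruncated_count v)) : barrow G :=
  @enum_val _ [pred a : barrow G | src a == v] (cast_ord (esym card_arrows_from) i).

Lemma src_arrow_from i : src (arrow_from i) = v.
Proof. by have /eqP := enum_valP (cast_ord (esym card_arrows_from) i). Qed.

Lemma arrow_from_inj : injective arrow_from.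
Proof. by move=> i j /enum_val_inj/cast_ord_inj. Qed.

Definition arrow_submod i : submodClosed P :=
  cyclic_submod (ract m (R (arrow_from i) 1)).

Lemma arrow_submodP i p :
  reflect (exists x, p = ract m (R (arrow_from i) 1 * x)) (p \in arrow_submod i).
Proof.
by apply: (iffP (cyclic_submodP _ _)) => -[x ->]; exists x; rewrite -ractA.
Qed.

(** Since $m = m e_v$, the decomposition of $x$ leaves in $m x$ only the coefficient at $e_v$ and
    the arrows starting at $v$. *)
Lemma sum_arrow_submodP x : sum_submod arrow_submod (ract m x) <-> baug v x = 0.
Proof.
have [mE gen _] := mP; split=> [[u uU mx]|x0].
  have [y yE] := choice (fun i => elimT (arrow_submodP i (u i)) (uU i)).
  rewrite (@corner_gen_aug _ _ _ mP x (\sum_i R (arrow_from i) 1 * y i)).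
    by rewrite baug_sum big1 // => i _; rewrite baugM baug_run ?mul0r.
  by rewrite mx ract_sum; apply: eq_bigr => i _; rewrite yE.
have [l lE] := bring_decomp x.
exists (fun i => ract m (R (arrow_from i) 1 * l (arrow_from i))).
  by move=> i; apply/arrow_submodP; exists (l (arrow_from i)).
rewrite -mE ractA lE mulrDr mulr_sumr big1 ?add0r => [|w _]; last first.
  rewrite mulrA -bscalarC -mulrA; have [->|wv] := eqVneq w v.
    by rewrite x0 bscalar0 mul0r.
  by rewrite bidem_orth ?mulr0 // eq_sym.
rewrite mulr_sumr (bigID (fun b => src b == v)) /= addrC.
rewrite big1 ?add0r => [|b bv]; last first.
  by rewrite mulrA bidem_mulR eq_sym (negPf bv) mul0r.
rewrite ract_sum (eq_bigl [in [pred a : barrow G | src a == v]]) //.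
rewrite big_enum_val (reindex (cast_ord (esym card_arrows_from))) /=; last first.
  by exists (cast_ord card_arrows_from) => i _; rewrite ?cast_ordK ?cast_ordKV.
apply: eq_bigr => i _.
by rewrite -/(arrow_from i) mulrA bidem_mulR src_arrow_from eqxx mE.
Qed.

(** The sum of the arrow submodules is proper and, by locality, contains every proper submodule; so
    it is the only maximal submodule. *)
Lemma radical_arrow_submod p : radical p <-> sum_submod arrow_submod p.
Proof.
have [mE gen _] := mP.
have m_notin : m \notin (sum_pred arrow_submod : submodClosed P).
  apply/negP => /asboolP; rewrite -[m]ract1 sum_arrow_submodP baug1 => /eqP.
  by rewrite oner_eq0.
have inS (U : submodClosed P) (x : B) : (exists q, q \notin U) -> ract m x \in U ->
    ract m x \in (sum_pred arrow_submod : submodClosed P).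
  move=> [q qU] xU; apply/asboolP/sum_arrow_submodP/eqP.
  apply: contraNT qU => x0; exact: (corner_gen_full mP xU).
split=> [rad_p|/asboolP pS U [Uproper Umax]].
  apply/asboolP/(rad_p (sum_pred arrow_submod)); split; first by exists m.
  move=> U SU; have [Ufull|] := pselect (forall q, q \in U); first by right.
  by case/existsNP=> q /negP qU; left=> r; have [x ->] := gen r; apply: inS; exists q.
have [|SU|Sfull] := Umax (sum_pred arrow_submod).
- by move=> r; have [x ->] := gen r; apply: inS.
- exact: SU.
- by rewrite Sfull in m_notin.
Qed.

Lemma arrow_submod_neq0 i k : (k <= run_len (arrow_from i))%N ->
  ract m (R (arrow_from i) k) != 0.
Proof.
move=> kN; apply/eqP => mR0; case/eqP: (brun_socle_neq0 B (arrow_from i)).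
have [_ _ inj] := mP; have := inj _ mR0; rewrite bidem_mulR src_arrow_from eqxx => R0.
by rewrite -(subnKC kN) -brun_mul R0 mul0r.
Qed.

Lemma arrow_submod_cases i p : p \in arrow_submod i -> p = 0 \/
  exists k x y, [/\ (0 < k <= run_len (arrow_from i))%N,
    p = ract m (R (arrow_from i) k * x) & x * y = 1].
Proof.
case/arrow_submodP=> x ->.
by case: (@brun_mul_cases _ _ _ (arrow_from i) 1 x isT) => [->|[k [u [u' [kN -> uu']]]]];
  [left; rewrite ract0r | right; exists k, u, u'].
Qed.

(** Nonzero elements are runs times units, and of two runs starting with the same arrow the longer
    is a multiple of the shorter. *)
Lemma arrow_submod_uniserial i : uniserial (submodule (arrow_submod i)).
Proof.
apply: chain_uniserial => -[p pU] [q qU].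
have sub_scale (r s : P) (rU : r \in arrow_submod i) (sU : s \in arrow_submod i) c :
    r = ract s c -> Submodule rU = (c : (bring B)^c) *: Submodule sU.
  by move=> rs; apply: val_inj; rewrite linearZ.
have [p0|[j [x [x' [/andP[_ jN] pE xx']]]]] := arrow_submod_cases pU.
  by left; exists 0; apply: sub_scale; rewrite p0 ract0r.
have [q0|[k [y [y' [/andP[_ kN] qE yy']]]]] := arrow_submod_cases qU.
  by right; exists 0; apply: sub_scale; rewrite q0 ract0r.
have [jk|/ltnW kj] := leqP j k; [right | left].
  (* The multiplier undoes [x], prolongs the run from length [j] to [k], then applies [y]. *)
  exists (x' * R (iter j next (arrow_from i)) (k - j) * y); apply: sub_scale.
  rewrite qE pE ractA; congr (ract m _).
  by rewrite !mulrA -[_ * x * x']mulrA xx' mulr1 brun_mul subnKC.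
exists (y' * R (iter k next (arrow_from i)) (j - k) * x); apply: sub_scale.
rewrite qE pE ractA; congr (ract m _).
by rewrite !mulrA -[_ * y * y']mulrA yy' mulr1 brun_mul subnKC.
Qed.

Lemma arrow_submod_indecomposable i :
  indecomposable (submodule (arrow_submod i)).
Proof.
apply: uniserial_indecomposable (@arrow_submod_uniserial i).
have aU : ract m (R (arrow_from i) 1) \in arrow_submod i.
  by apply/arrow_submodP; exists 1; rewrite mulr1.
exists (Submodule aU); rewrite -val_eqE /=.
exact/arrow_submod_neq0/ltnW/run_len_gt1.
Qed.

Lemma run_arrow_submod i j k : (0 < k < run_len (arrow_from i))%N ->
  ract m (R (arrow_from i) k) \in arrow_submod j -> i = j.
Proof.
move=> kN /arrow_submodP[x] /(corner_gen_eq mP).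
rewrite mulrA !bidem_mulR !src_arrow_from !eqxx => /(brun_arrow_eq kN) ij.
by apply: arrow_from_inj; rewrite ij.
Qed.

Lemma arrow_submod_inj i j : arrow_submod i =i arrow_submod j -> i = j.
Proof.
move=> ij; apply: (@run_arrow_submod i j 1); first exact: run_len_gt1.
by rewrite -ij; apply/arrow_submodP; exists 1; rewrite mulr1.
Qed.

(** A nonzero element of the intersection is a run times a unit, and by [run_arrow_submod] the run
    must be full; so every nonzero element generates the same submodule as the full run [z]. *)
Lemma arrow_submodI_simple i j : i != j ->
  simple (submodule (submodI (arrow_submod i) (arrow_submod j))).
Proof.
move=> ij; set z := ract m (R (arrow_from i) (run_len (arrow_from i))).
have zcases p : p \in submodI (arrow_submod i) (arrow_submod j) ->
    p = 0 \/ exists x y, p = ract z x /\ x * y = 1.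
  rewrite inE => /andP[pi pj].
  have [->|[k [x [y [/andP[k0 kN] pE xy]]]]] := arrow_submod_cases pi; first by left.
  right; exists x, y; split=> //; rewrite /z ractA pE.
  have [kN'|//|->//] := ltngtP k (run_len (arrow_from i)); last by rewrite ltnNge kN.
  case/eqP: ij; apply: (@run_arrow_submod i j k); first by rewrite k0.
  have -> : ract m (R (arrow_from i) k) = ract p y.
    by rewrite pE ractA -mulrA xy mulr1.
  exact: ract_sub.
have socle_in k : ract m (R (arrow_from k) (run_len (arrow_from k))) \in arrow_submod k.
  apply/arrow_submodP; rewrite -(subnKC (ltnW (run_len_gt1 (arrow_from k)))).
  by rewrite -brun_mul; eexists.
(* Full runs with the same source coincide by the type one relations. *)
have zU : z \in submodI (arrow_submod i) (arrow_submod j).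
  rewrite inE socle_in /z (@brun_socle _ _ _ _ (arrow_from j)) ?socle_in //.
  by rewrite !src_arrow_from.
split; first by exists (Submodule zU); rewrite -val_eqE /= arrow_submod_neq0.
move=> U; have [U0|] := pselect {in U, forall p, p = 0}; first by left.
case/existsNP=> p /not_implyP[pU /eqP p0]; right=> q.
have pz (x : B) : Submodule zU = (x : (bring B)^c) *: p -> q \in U.
  move=> zE; have [q0|[y [_ [qE _]]]] := zcases _ (valP q).
    have -> : q = 0 by apply: val_inj.
    exact: rpred0.
  have -> : q = (y : (bring B)^c) *: Submodule zU by apply: val_inj; rewrite linearZ.
  by rewrite zE !rpredZ.
have [pz0|[x [y [pE xy]]]] := zcases _ (valP p).
  by case/eqP: p0; apply: val_inj.
apply: (pz y); apply: val_inj; rewrite linearZ -[RHS]/(ract (val p) y).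
by rewrite pE ractA xy ract1.
Qed.

End Radical.

End BrauerModules.

(** * Brauer configuration algebras *)

Section BrauerAlgebra.
Local Open Scope ring_scope.
Variables (K : fieldType) (G : brauer_config).
Local Notation src a := (tag (aocc a)).
Local Notation next := (@anext G).
Local Notation KQ := (path_alg_ring (bquiver G) K).
Local Notation rel := (@brauer_rel G K).
Implicit Types a b : barrow G.

Definition brauer_proj : {rmorphism KQ -> brauer_alg G K} := qproj rel.

Lemma cycle_powE a : cycle_pow K a = pelt KQ (run a (run_len a)).
Proof. exact: (special_cycle_pow KQ). Qed.

Lemma arrow_eltE a : @arrow_elt (bquiver G) K a = pelt KQ (run a 1).
Proof. by rewrite run1. Qed.

Lemma brauer_proj_eq0 (x : KQ) : brauer_proj x = 0 <-> ideal_gen rel x.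
Proof.
rewrite -(rmorph0 brauer_proj); split=> [/qprojP|xI]; first by rewrite subr0.
by apply/qprojP; rewrite subr0.
Qed.

Fact brauer_proj_rel1 a b : src a = src b ->
  brauer_proj (pelt KQ (run a (run_len a))) = brauer_proj (pelt KQ (run b (run_len b))).
Proof.
move=> ab; apply/qprojP; rewrite -!cycle_powE.
exact/ideal_gen_sub/brauer_rel1.
Qed.

Fact brauer_proj_rel2 a :
  brauer_proj (pelt KQ (run a (run_len a))) * brauer_proj (pelt KQ (run a 1)) = 0.
Proof.
rewrite -rmorphM; apply/brauer_proj_eq0; rewrite -cycle_powE -arrow_eltE.
exact/ideal_gen_sub/brauer_rel2.
Qed.

(** Arrows that do not compose have product zero already in the path algebra; the others give a type
    three relation, since in the exceptional square of a loop [b] would be [next a]. *)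
Fact brauer_proj_rel3 a b : b <> next a ->
  brauer_proj (pelt KQ (run a 1)) * brauer_proj (pelt KQ (run b 1)) = 0.
Proof.
move=> ba; rewrite -rmorphM; apply/brauer_proj_eq0.
have [ab|ab] := eqVneq (src (next a)) (src b).
  rewrite -!arrow_eltE; apply/ideal_gen_sub/brauer_rel3 => // [c|[aE [v1 _]]].
    by apply/negP => /infix_special_cycle.
  by case: ba; rewrite -aE; have := iter_valency a; rewrite v1 /= => ->.
rewrite (_ : _ * _ = 0); first exact: ideal_gen0.
case: (path_mulP KQ (run a 1) (run b 1)) => // r.
by rewrite path_tgt_run => /eqP; rewrite (negPf ab).
Qed.

Fact aug_ker v (f : KQ) : brauer_proj f = 0 -> aug v f = 0.
Proof.
move/brauer_proj_eq0; apply: (aug_ideal_gen (X := KQ)) => _ [a b _|a|a b _ _ _].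
- by rewrite !cycle_powE; apply: (aug_rel1 KQ).
- exact: (aug_arrow_mulr (KQ := KQ)).
- exact: (aug_arrow_mulr (KQ := KQ)).
Qed.

Fact socle_form_ker (f : KQ) : brauer_proj f = 0 -> socle_form f = 0.
Proof.
move/brauer_proj_eq0; apply: (socle_form_ideal_gen (KQ := KQ)).
move=> _ [a b ab|a|a b ab ninf nloop] g h.
- by rewrite !cycle_powE; apply: (socle_form_rel1 (KQ := KQ)).
- by rewrite cycle_powE; apply: (socle_form_rel2 (KQ := KQ)).
- by apply: (socle_form_rel3 (KQ := KQ)); apply: rel3_neq_next.
Qed.

Definition brauer_alg_ring : brauer_ring K G :=
  @BrauerRing K G KQ (brauer_alg G K) brauer_proj (@qrepr KQ rel) (@qreprK KQ rel)
    brauer_proj_rel1 brauer_proj_rel2 brauer_proj_rel3 aug_ker socle_form_ker.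

Fact idem_in v : idem K v \in (@idem_pred G K v : {pred ((brauer_alg G K)^c)^o}).
Proof. by apply/asboolP; exists 1; rewrite mulr1. Qed.

Lemma proj_module_gen v :
  @corner_gen K G brauer_alg_ring (proj_module K v) v (Submodule (idem_in v)).
Proof.
split=> [|p|x x0].
- by apply: val_inj; apply: (bidem_idem brauer_alg_ring).
- have /asboolP[y pE] := valP p; exists y; apply: val_inj; exact: pE.
- exact: (congr1 val x0).
Qed.

End BrauerAlgebra.

Theorem theoremB (K : fieldType) (G : brauer_config) :
  (exists f : pi_class (brauer_alg G K)^c -> plabel G,
     bijective f /\
     forall (c : pi_class (brauer_alg G K)^c) (P : rmodType (brauer_alg G K)),
       sval c P -> isomorphic P (proj_module K (f c))) /\
  (forall (P : rmodType (brauer_alg G K)) (V : plabel G),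
     projective P -> indecomposable P -> isomorphic P (proj_module K V) ->
     exists U : 'I_(nontruncated_count V) -> submodClosed P,
       [/\ forall x : P, radical x <-> sum_submod U x,
           forall i, indecomposable (submodule (U i))
                     /\ uniserial (submodule (U i)),
           forall i j, U i =i U j -> i = j
         & forall i j, i != j -> simple (submodule (submodI (U i) (U j)))]).
Proof.
split; last first.
  move=> P V _ _ /isomorphic_sym PV.
  have [m mP] := corner_gen_iso (@proj_module_gen K G V) PV.
  exists (arrow_submod (B := brauer_alg_ring K G) m); split.
  - exact: (radical_arrow_submod mP).
  - move=> i; split; first exact: (arrow_submod_indecomposable mP).
    exact: (@arrow_submod_uniserial K G (brauer_alg_ring K G) P V m i).
  - exact: (arrow_submod_inj mP).
  - exact: (arrow_submodI_simple mP).
(* A representative has a generator as in [corner_gen] for some $v$, so the whole class is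
   isomorphic to $e_v\Lambda$. *)
have class (c : pi_class (brauer_alg G K)^c) : exists v,
    forall P, sval c P -> isomorphic P (proj_module K v).
  case: c => C [P0 [projP0 indP0 /= ->]].
  have [v [m mP0]] := @projective_corner_gen K G (brauer_alg_ring K G) P0 projP0 indP0.
  exists v => P /isomorphic_sym PP0; apply: isomorphic_trans PP0 _.
  exact: (corner_gen_isomorphic mP0 (@proj_module_gen K G v)).
have [f fP] := choice class; exists f; split=> //.
pose g v : pi_class (brauer_alg G K)^c := exist _ (isomorphic (proj_module K v))
  (ex_intro _ (proj_module K v) (And3 (corner_gen_projective (@proj_module_gen K G v))
     (corner_gen_indecomposable (@proj_module_gen K G v)) erefl)).
have iso_refl (P : rmodType (brauer_alg G K)) : isomorphic P P.
  by exists idfun; exists idfun.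
exists g => [c|v]; last first.
  (* The class of $e_v\Lambda$ is sent back to $v$ because the vertex of a generator is unique. *)
  have vfv := fP (g v) _ (iso_refl _).
  have [n nP] := corner_gen_iso (@proj_module_gen K G v) vfv.
  by apply/esym/(corner_gen_uniq nP (@proj_module_gen K G _)).
case: c (fP c) => C [P0 [projP0 indP0 CE]] /= fc.
(* Two classes are equal once their predicates are, and isomorphic modules define the same
   predicate. *)
apply: eq_exist; rewrite [RHS]CE; apply/esym/isomorphic_class/fc; rewrite CE.
exact: iso_refl.
Qed.
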